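(* Let $(G,+)$ be a nontrivial compact connected metric abelian group with normalized Haar measure $\mu$. Then: (1) For all $\nu>1/2$ and all $f\in L^2_0(G)$, $$\mu\otimes\mu\left(\left\{(u,x)\in G^2:\ \limsup_{n\to\infty}\frac{|S_{n,u}f(x)|}{n^\nu}\geq 1\right\}\right)=0.$$ (2) There exists a residual subset $\mathcal R\subset\mathcal C_0(G)$ such that, for all $f\in\mathcal R$, $$\mu\otimes\mu\left(\left\{(u,x)\in G^2:\ \limsup_{n\to\infty}\frac{|S_{n,u}f(x)|}{n^{1/2}}=+\infty\right\}\right)=1.$$
   Context: Fix a scalar field, $\mathbb R$ or $\mathbb C$ (either is allowed). $\mathcal C_0(G)$ is the space of continuous scalar-valued functions $f$ on $G$ with $\int_G f\,d\mu=0$, equipped with the sup norm; $L^2_0(G)$ is the space of $f\in L^2(G,\mu)$ with $\int_G f\,d\mu=0$. For $u,x\in G$ and $n\ge 1$, $S_{n,u}f(x)=\sum_{k=0}^{n-1}f(x+ku)$. A subset of a complete metric space is residual if it contains a countable intersection of dense open sets. *)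

(* Defs.v *)
From HB Require Import structures.
From mathcomp Require Import all_boot all_order all_algebra.
From mathcomp Require Import complex.
From mathcomp Require Import all_classical all_reals all_analysis.
From mathcomp Require Import borel_hierarchy.

Set Implicit Arguments.
Unset Strict Implicit.
Unset Printing Implicit Defensive.

Import Order.TTheory GRing.Theory Num.Theory.
Import numFieldNormedType.Exports.

Local Open Scope classical_set_scope.
Local Open Scope ring_scope.

Record metrized_by (R : realType) (T : topologicalType) (dist : T -> T -> R) :
    Prop := MetrizedBy {
  dist_eq0 : forall x y, dist x y = 0 <-> x = y;
  dist_sym : forall x y, dist x y = dist y x;
  dist_triangle : forall x y z, dist x z <= dist x y + dist y z;
  nbhs_dist : forall (x : T) (A : set T),
    nbhs x A <-> exists2 e, 0 < e & [set y | dist x y < e] `<=` A }.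

(* Measurable types are pointed, whereas topological groups are not declared
   so; hence the copy of G pointed at 0. *)
Definition pointed_at0 (G : topologicalZmodType) : Type := G.
HB.instance Definition _ (G : topologicalZmodType) :=
  TopologicalZmodule.on (pointed_at0 G).
HB.instance Definition _ (G : topologicalZmodType) :=
  isPointed.Build (pointed_at0 G) (0 : G).

Definition borel (G : topologicalZmodType) :=
  g_sigma_algebraType (@open (pointed_at0 G)).
HB.instance Definition _ (G : topologicalZmodType) := Measurable.on (borel G).

Definition haar_measure (R : realType) (G : topologicalZmodType)
    (mu : {measure set (borel G) -> \bar R}) :=
  forall (a : G) (A : set G), measurable (A : set (borel G)) ->
    mu [set a + x | x in A] = mu A.

Definition residual (T : topologicalType) (A : set T) :=
  exists2 B : set T, Gdelta_dense B & B `<=` A.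

Section scalars.
Context {R : realType}.

Variant scalars := RealScalars | ComplexScalars.

Definition scalar_field (s : scalars) : numFieldType :=
  match s with RealScalars => R | ComplexScalars => R[i] end.

(* The library norm of R[i] takes its values in R[i]; this one is R-valued. *)
Definition modulus (s : scalars) : scalar_field s -> R :=
  match s with
  | RealScalars => fun z : R => `|z|
  | ComplexScalars => fun z : R[i] => Normc.normc z
  end.

Definition scalar_integral d (T : measurableType d)
    (mu : {measure set T -> \bar R}) (s : scalars) :
    (T -> scalar_field s) -> scalar_field s :=
  match s with
  | RealScalars => fun f : T -> R => \int[mu]_x f x
  | ComplexScalars => fun f : T -> R[i] =>
      Complex (\int[mu]_x complex.Re (f x)) (\int[mu]_x complex.Im (f x))
  end.

End scalars.

Arguments scalar_field R s : clear implicits.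
Arguments modulus {R} [s] _.

Section modulus_lemmas.
Context {R : realType} {s : scalars}.
Implicit Types z w : scalar_field R s.

Lemma modulus_eq0 z : modulus z = 0 <-> z = 0.
Proof.
split=> [|->]; last by case: s; [exact: normr0|exact: Normc.normc0].
by case: s z => /= z; [move/eqP; rewrite normr_eq0 => /eqP|exact: Normc.eq0_normc].
Qed.

Lemma modulus_ge0 z : 0 <= modulus z.
Proof. by case: s z => /= [z|[a b]]; [exact: normr_ge0|exact: sqrtr_ge0]. Qed.

Lemma modulusN z : modulus (- z) = modulus z.
Proof. by case: s z => /= z; [rewrite normrN|exact: normcN]. Qed.

Lemma modulusD z w : modulus (z + w) <= modulus z + modulus w.
Proof. by case: s z w => /= z w; [exact: ler_normD|exact: le_normcD]. Qed.

Lemma modulus_dist z w : `|modulus z - modulus w| <= modulus (z - w).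
Proof.
have h (x y : scalar_field R s) : modulus x - modulus y <= modulus (x - y).
  by have := modulusD (x - y) y; rewrite subrK lerBlDr.
by rewrite ler_norml h andbT lerNl opprB -(modulusN (z - w)) opprB h.
Qed.

Lemma modulus_continuous : continuous (@modulus R s).
Proof.
move=> z; apply/(@cvgrPdist_lt _ _ _ (nbhs z)) => e e0.
have [eK eK0 eKP] : exists2 eK : scalar_field R s, 0 < eK &
    forall v : scalar_field R s, `|v| < eK -> modulus v < e.
  case: s => /=; first by exists e.
  by exists e%:C%C => [|v]; rewrite ?normc_def ltcR//; case: v.
have /cvgrPdist_lt/(_ _ eK0) := @cvg_id _ (nbhs z).
by apply: filterS => w /eKP; exact/le_lt_trans/modulus_dist.
Qed.

End modulus_lemmas.

Section C0.
Context {R : realType} {G : topologicalZmodType}.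
Variables (mu : {measure set (borel G) -> \bar R}) (s : scalars).

Record C0 : Type := MkC0 {
  C0_fun :> G -> scalar_field R s;
  C0_continuous : continuous C0_fun;
  C0_integral0 : scalar_integral mu C0_fun = 0 }.

Definition sup_norm (f : G -> scalar_field R s) : R :=
  sup (range (fun x => modulus (f x))).

Definition sup_dist (f g : C0) : R := sup_norm (fun x => f x - g x).

Context (cG : compact [set: G]).

Lemma sup_dist_has_ubound (f g : C0) :
  has_ubound (range (fun x => modulus (f x - g x))).
Proof.
have : compact (range (fun x => modulus (f x - g x))).
  apply: continuous_compact => //; apply: continuous_subspaceT => x.
  apply: (@continuous_comp _ _ _ (fun x => f x - g x)).
    by apply: cvgB; exact: C0_continuous.
  exact: modulus_continuous.
move=> /compact_bounded[M [_ /(_ (M + 1))]].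
rewrite ltrDl ltr01 => /(_ isT) h; exists (M + 1) => y /h.
by apply: le_trans; exact: ler_norm.
Qed.

Lemma le_sup_dist (f g : C0) x : modulus (f x - g x) <= sup_dist f g.
Proof.
by apply: (ub_le_sup (sup_dist_has_ubound f g)); exists x.
Qed.

Lemma sup_dist_le (f g : C0) e :
  (forall x, modulus (f x - g x) <= e) -> sup_dist f g <= e.
Proof.
by move=> h; apply: ge_sup; [exists (modulus (f 0 - g 0)), 0|move=> _ [x _ <-]].
Qed.

Lemma sup_distxx (f : C0) : sup_dist f f = 0.
Proof.
have m0 x : modulus (f x - f x) = 0 by apply/modulus_eq0; rewrite subrr.
by apply/eqP; rewrite eq_le sup_dist_le => [|x]; rewrite -?{1}(m0 0) ?le_sup_dist ?m0.
Qed.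

Lemma sup_dist_positivity (f g : C0) : sup_dist f g = 0 -> f = g.
Proof.
move=> fg0; have fg : C0_fun f = C0_fun g.
  apply/funext => x; apply/eqP; rewrite -subr_eq0; apply/eqP/modulus_eq0/eqP.
  have := le_sup_dist f g x; rewrite fg0 eq_le => ->/=.
  exact: modulus_ge0.
case: f g fg {fg0} => f cf If [g cg Ig] /= fg; case: g / fg cg Ig => cg Ig.
by congr MkC0; exact: Prop_irrelevance.
Qed.

Lemma sup_dist_sym (f g : C0) : sup_dist f g = sup_dist g f.
Proof.
rewrite /sup_dist /sup_norm; have -> // : (fun x => modulus (f x - g x)) =
  (fun x => modulus (g x - f x)).
by apply/funext => x; rewrite -modulusN opprB.
Qed.

Lemma sup_dist_triangle (g f h : C0) : sup_dist f h <= sup_dist f g + sup_dist g h.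
Proof.
apply: sup_dist_le => x; have := modulusD (f x - g x) (g x - h x).
rewrite addrA subrK => /le_trans; apply; apply: lerD; exact: le_sup_dist.
Qed.

(* C0 as a metric space; its distance is only known to be a metric once G is
   compact, which is why the type carries the proof. *)
Definition C0_space of compact [set: G] : Type := C0.

End C0.

HB.instance Definition _ (R : realType) (G : topologicalZmodType)
    (mu : {measure set (borel G) -> \bar R}) (s : scalars)
    (cG : compact [set: G]) := gen_eqMixin (C0_space mu s cG).
HB.instance Definition _ (R : realType) (G : topologicalZmodType)
    (mu : {measure set (borel G) -> \bar R}) (s : scalars)
    (cG : compact [set: G]) := gen_choiceMixin (C0_space mu s cG).
HB.instance Definition _ (R : realType) (G : topologicalZmodType)
    (mu : {measure set (borel G) -> \bar R}) (s : scalars)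
    (cG : compact [set: G]) :=
  @isMetric.Build R (C0_space mu s cG) (@sup_dist R G mu s)
    (@sup_distxx R G mu s cG) (@sup_dist_positivity R G mu s cG)
    (@sup_dist_sym R G mu s) (@sup_dist_triangle R G mu s cG).

Section ergodic_sums.
Context {R : realType} {G : topologicalZmodType} {s : scalars}.

Definition L2_0 (mu : {measure set (borel G) -> \bar R}) :
    set (G -> scalar_field R s) :=
  [set f | [/\ measurable_fun setT (f : borel G -> borel (scalar_field R s)),
    finite_norm mu 2%:E (fun x => modulus (f x)) &
    scalar_integral mu f = 0]].

Definition ergodic_sum (n : nat) (u : G) (f : G -> scalar_field R s) (x : G) :
    scalar_field R s :=
  \sum_(k < n) f (x + u *+ k).

(* The extra term n = 0 has value 0 and does not affect the limsup. *)
Definition limsup_ergodic (nu : R) (f : G -> scalar_field R s) (u x : G) :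
    \bar R :=
  limn_esup (fun n => (modulus (ergodic_sum n u f x) / n%:R `^ nu)%:E).

End ergodic_sums.

(* Main.v *)
Require Import Defs.
From HB Require Import structures.
From mathcomp Require Import all_boot all_order all_algebra.
From mathcomp Require Import complex ring lra zify.
From mathcomp Require Import all_classical all_reals all_analysis measurable_realfun.
Set Implicit Arguments.
Unset Strict Implicit.
Unset Printing Implicit Defensive.
Import Order.TTheory GRing.Theory Num.Theory.
Import numFieldNormedType.Exports.
Local Open Scope classical_set_scope.
Local Open Scope ring_scope.

(** For fixed [k < l] the points [x + k u] and [x + l u] are independent and Haar
    distributed: this reduces to the invariance of [mu] under [y |-> n y], which
    holds because a compact connected group is divisible.

    Hence the functions [f (x + k u)] are orthogonal in [L^2], with constant norm.
    The Rademacher-Menshov inequality bounds the mean square of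
    [max_(n <= 2^j) |S_n|] by a constant times [j^2 2^j], which is summable after
    division by [2^(2 nu j)], so that [S_n = o(n^nu)] almost everywhere.

    For (2), cut [G] up to small measure into continuous cells of small measure and
    put independent random signs on them. With high probability the first [N]
    points of the orbit visit distinct cells, so [S_n] is there a simple random
    walk, and this leaves the parabola [|S_n| <= M sqrt n] before time [N] with
    high probability. A good choice of signs, corrected by its small mean, gives
    an escaping function [g]. For [f] arbitrary, the events that [f + i tau g]
    is confined ([i < L]) are almost disjoint, so one of them has small measure;
    as confinement up to time [N] is stable under small perturbations, the
    functions which escape form a dense open set.

    For divisibility, let [F x] be the distance from [- x] to [p G] and restrict
    [F] to the sums [a_1 x_1 + ... + a_r x_r], with [a] in [(Z/p)^r], for a fine
    net [x_1, ..., x_r]. By compactness the almost periods of [F] have density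
    bounded below, independently of [r]. By connectedness there are enough of them
    to make every nontrivial Fourier coefficient of [F] small. By Parseval the
    autocorrelation is then small, so [F] is nearly constant. *)

(** * Fourier analysis on [(Z/p)^r] *)

Section finite_fourier.
Variables (p r : nat) (C : numClosedFieldType).
Hypothesis p_pr : prime p.
Local Notation A := 'rV['F_p]_r.

Definition dotv (b a : A) : 'F_p := \sum_i b 0 i * a 0 i.

Lemma dotvDr b a c : dotv b (a + c) = dotv b a + dotv b c.
Proof. by rewrite -big_split; apply: eq_bigr => i _; rewrite mxE mulrDr. Qed.

Lemma dotv0 b : dotv b 0 = 0.
Proof. by rewrite /dotv big1 // => i _; rewrite mxE mulr0. Qed.

Lemma dotvNr b a : dotv b (- a) = - dotv b a.
Proof. by rewrite -sumrN; apply: eq_bigr => i _; rewrite mxE mulrN. Qed.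

Lemma dotvBr b a c : dotv b (a - c) = dotv b a - dotv b c.
Proof. by rewrite dotvDr dotvNr. Qed.

Lemma dotvMnr b a n : dotv b (a *+ n) = dotv b a *+ n.
Proof. by elim: n => [|n IH]; rewrite ?mulr0n ?dotv0// !mulrS dotvDr IH. Qed.

Lemma dotvC b a : dotv b a = dotv a b.
Proof. by apply: eq_bigr => i _; rewrite mulrC. Qed.

Lemma dotv_delta b i : dotv b (delta_mx 0 i) = b 0 i.
Proof.
rewrite /dotv (bigD1 i)//= mxE !eqxx mulr1 big1 ?addr0// => j ji.
by rewrite mxE (negPf ji) andbF mulr0.
Qed.

(** A root of 1 + X + ... + X^(p-1), which a closed field provides, is a [p]-th root of unity; it is
    not 1, since [p] is nonzero in characteristic zero. *)
Lemma exists_unity_root : exists2 z : C, z ^+ p = 1 & z != 1.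
Proof.
have pgt1 := prime_gt1 p_pr.
have [|z hz] := @solve_monicpoly C p.-1 (fun=> -1); first by case: (p) pgt1 => [|[]].
have hs : \sum_(i < p) z ^+ i = 0.
  rewrite -(big_mkord xpredT (fun i => z ^+ i)) -(prednK (prime_gt0 p_pr)).
  rewrite big_nat_recr//= hz big_mkord -big_split /=.
  by rewrite big1// => i _; rewrite mulN1r subrr.
exists z.
  by apply/eqP; rewrite -subr_eq0 subrX1 hs mulr0.
apply/eqP => z1; move: hs; rewrite z1.
under eq_bigr do rewrite expr1n.
rewrite sumr_const card_ord => /eqP; rewrite pnatr_eq0.
by case: (p) pgt1.
Qed.

Variable z : C.
Hypotheses (zp : z ^+ p = 1) (z1 : z != 1).

Definition chr (x : 'F_p) : C := z ^+ (x : nat).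

Lemma chr_nat n : chr n%:R = z ^+ n.
Proof.
rewrite /chr val_Fp_nat// [in RHS](divn_eq n p) exprD mulnC exprM zp expr1n.
by rewrite mul1r.
Qed.

Lemma chrD x y : chr (x + y) = chr x * chr y.
Proof. by rewrite -{1}(natr_Zp x) -{1}(natr_Zp y) -natrD chr_nat exprD. Qed.

Lemma chr0 : chr 0 = 1. Proof. by rewrite /chr expr0. Qed.

Lemma chrMn x n : chr (x *+ n) = chr x ^+ n.
Proof. by elim: n => [|n IH]; rewrite ?chr0// mulrS chrD IH exprS. Qed.

Lemma norm_chr x : `|chr x| = 1.
Proof.
have : `|z| ^+ p = 1 by rewrite -normrX zp normr1.
move/eqP; rewrite pexpr_eq1 ?prime_gt0// => /eqP z_norm.
by rewrite normrX z_norm expr1n.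
Qed.

Lemma chrN x : chr (- x) = (chr x)^*.
Proof.
have x0 : chr x != 0 by rewrite -normr_eq0 norm_chr oner_eq0.
apply: (mulfI x0); rewrite -chrD subrr chr0.
by rewrite -normCK norm_chr expr1n.
Qed.

Lemma chr_pow x : chr x ^+ p = 1.
Proof. by rewrite /chr -exprM mulnC exprM zp expr1n. Qed.

Lemma chr_eq1 x : chr x = 1 -> x = 0.
Proof.
move=> hx; apply/eqP/negP => /negP x0; case/eqP: z1.
(* In a prime field 1 is an integer multiple of any nonzero [x], so [chr x = 1] would force
   [z = 1]. *)
have -> : z = chr (x * x^-1) by rewrite divff// (chr_nat 1).
rewrite -(natr_Zp (x^-1)) mulr_natr chrMn hx expr1n//.
Qed.

(** If [a 0 i] is nonzero, translating the summation variable by the [i]-th basis vector multiplies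
    the sum by [chr (a 0 i)], which is not 1. *)
Lemma sum_chr (a : A) :
  \sum_b chr (dotv b a) = if a == 0 then #|{: A}|%:R else 0.
Proof.
have [->|a0] := eqVneq a 0.
  under eq_bigr do rewrite dotv0 chr0.
  by rewrite sumr_const.
have /rV0Pn[i ai] := a0.
set S := \sum_b _.
have hS : S = S * chr (a 0 i).
  rewrite {1}/S (reindex_inj (addrI (delta_mx 0 i))) /= big_distrl /=.
  apply: eq_bigr => b _.
  by rewrite dotvC dotvDr dotv_delta chrD dotvC mulrC.
have : S * (1 - chr (a 0 i)) = 0 by rewrite mulrBr mulr1 -hS subrr.
move/eqP; rewrite mulf_eq0 => /orP[/eqP//|]; rewrite subr_eq0 => /eqP h.
by move/esym/chr_eq1: h ai => ->; rewrite eqxx.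
Qed.

Definition fourier (f : A -> C) (b : A) : C := \sum_a f a * chr (dotv b a).

Lemma parseval (f : A -> C) :
  \sum_b `|fourier f b| ^+ 2 = #|{: A}|%:R * \sum_a `|f a| ^+ 2.
Proof.
have -> : \sum_b `|fourier f b| ^+ 2 =
    \sum_a \sum_c f a * (f c)^* * \sum_b chr (dotv b (a - c)).
  rewrite exchange_big /=.
  under [RHS]eq_bigr do under eq_bigr do rewrite mulr_sumr.
  under [RHS]eq_bigr do rewrite exchange_big.
  rewrite exchange_big /=; apply: eq_bigr => b _.
  rewrite normCK {2}/fourier rmorph_sum /= mulr_sumr; apply: eq_bigr => c _.
  rewrite mulr_suml; apply: eq_bigr => a _.
  rewrite rmorphM /= -chrN dotvBr chrD; ring.
rewrite mulr_sumr; apply: eq_bigr => a _.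
rewrite (bigD1 a)//= sum_chr subrr eqxx big1 ?addr0 => [|c ca].
  by rewrite normCK mulrC.
by rewrite sum_chr subr_eq0 eq_sym (negPf ca) mulr0.
Qed.

Definition autocorr (f : A -> C) (t : A) : C := \sum_a f a * f (a + t).

(** The Wiener-Khinchin identity; realness of [f] lets the unconjugated autocorrelation stand for
    the usual one. *)
Lemma fourier_autocorr (f : A -> C) b : (forall a, f a \is Num.real) ->
  fourier (autocorr f) b = `|fourier f b| ^+ 2.
Proof.
move=> fr; rewrite normCK /fourier /autocorr rmorph_sum /= mulr_sumr.
under eq_bigr do rewrite mulr_suml.
rewrite exchange_big /=; apply: eq_bigr => a _.
rewrite (reindex_inj (addIr (- a))) /= mulr_suml; apply: eq_bigr => t _.
rewrite rmorphM /= -chrN (CrealP (fr a)) dotvBr chrD addrC subrK; ring.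
Qed.

(** With [x = chr (dotv b t)], the product of [1 - x ^+ j] and the coefficient is a transform of the
    difference of [f] along [t *+ j], which is at most [j%:R * d]. The powers of [x] sum to zero, so
    summing over [j < p] recovers [p] times the coefficient; no lower bound on [|1 - x|] is
    required. *)
Lemma norm_fourier_le (f : A -> C) (d : C) b t : 0 <= d ->
  (forall a, `|f (a + t) - f a| <= d) -> dotv b t != 0 ->
  `|fourier f b| <= #|{: A}|%:R * p%:R * d.
Proof.
move=> d0 ft bt.
have ftj a j : `|f (a + t *+ j) - f a| <= j%:R * d.
  elim: j => [|j IH]; first by rewrite mulr0n addr0 subrr normr0 mul0r.
  rewrite mulrSr addrA -(subrK (f (a + t *+ j)) (f (_ + t))) -addrA.
  rewrite (le_trans (ler_normD _ _))// -[j.+1]add1n natrD mulrDl mul1r.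
  exact: lerD.
pose x := chr (dotv b t).
have x1 : x != 1 by apply: contra bt => /eqP/chr_eq1 ->.
have sx : \sum_(j < p) x ^+ j = 0.
  have /eqP : (x - 1) * \sum_(j < p) x ^+ j = 0.
    by rewrite -subrX1 /x chr_pow subrr.
  by rewrite mulf_eq0 subr_eq0 (negPf x1) /= => /eqP.
have pE : p%:R * fourier f b = \sum_(j < p) (1 - x ^+ j) * fourier f b.
  rewrite -mulr_suml sumrB sx subr0; congr (_ * _).
  by rewrite sumr_const card_ord.
have xj (j : 'I_p) : `|(1 - x ^+ j) * fourier f b| <= #|{: A}|%:R * p%:R * d.
  have -> : (1 - x ^+ j) * fourier f b =
      \sum_a (f (a + t *+ j) - f a) * chr (dotv b (a + t *+ j)).
    under [RHS]eq_bigr do rewrite mulrBl.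
    rewrite sumrB mulrBl mul1r; congr (_ - _).
      by rewrite {1}/fourier (reindex_inj (addIr (t *+ j))).
    rewrite /fourier mulr_sumr; apply: eq_bigr => a _.
    by rewrite dotvDr dotvMnr chrD chrMn -/x; ring.
  rewrite (le_trans (ler_norm_sum _ _ _))//.
  have -> : #|{: A}|%:R * p%:R * d = \sum_(a : A) p%:R * d.
    by rewrite sumr_const -[RHS]mulr_natl mulrA.
  apply: ler_sum => a _; rewrite normrM norm_chr mulr1.
  apply: le_trans (ftj _ _) _; apply: ler_wpM2r => //.
  by rewrite ler_nat ltnW.
have p0 : 0 < p%:R :> C by rewrite ltr0n prime_gt0.
rewrite -(ler_pM2l p0) -[X in X * `|_|]ger0_norm ?ler0n// -normrM pE.
rewrite (le_trans (ler_norm_sum _ _ _))//.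
have -> : p%:R * (#|{: A}|%:R * p%:R * d) =
    \sum_(j < p) #|{: A}|%:R * p%:R * d.
  by rewrite sumr_const card_ord mulr_natl.
exact: ler_sum.
Qed.

(* The autocorrelation is at least half its maximum on [S], while [d] bounds all the
   nontrivial Fourier coefficients of [f], hence the total autocorrelation. *)
Lemma near_period_count (f : A -> C) (eta d : C) (S : {set A}) :
  (forall a, f a \is Num.real) -> \sum_a f a = 0 -> 0 <= d -> 0 <= eta ->
  #|{: A}|%:R * eta ^+ 2 <= \sum_a f a ^+ 2 ->
  (forall t a, t \in S -> `|f (a + t) - f a| <= eta) ->
  (forall b, b != 0 ->
     exists2 t, forall a, `|f (a + t) - f a| <= d & dotv b t != 0) ->
  #|S|%:R * \sum_a f a ^+ 2 <= 4 * (#|{: A}|%:R * p%:R * d) ^+ 2.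
Proof.
move=> fr f0 d0 e0 hV hS hd.
set N := #|{: A}|%:R : C; set V := \sum_a f a ^+ 2 in hV *.
have N0 : 0 < N by rewrite ltr0n; apply/card_gt0P; exists 0.
have V0 : 0 <= V by apply: sumr_ge0 => a _; rewrite real_exprn_even_ge0.
have psir t : autocorr f t \is Num.real.
  by apply: sum_real => a _; apply: realM.
(* Polarization: a small mean square of the difference means an autocorrelation close to its value
   [V] at 0. *)
have psiE t : 2 * autocorr f t = 2 * V - \sum_a (f (a + t) - f a) ^+ 2.
  have -> : 2 * V = \sum_a f a ^+ 2 + \sum_a f (a + t) ^+ 2.
    rewrite mulr_natl mulr2n; congr (_ + _).
    by rewrite /V (reindex_inj (addIr t)).
  rewrite -big_split /= -sumrB /autocorr mulr_sumr; apply: eq_bigr => a _; ring.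
have psiS t : t \in S -> V <= 2 * autocorr f t.
  move=> tS; rewrite psiE mulr_natl mulr2n -addrA lerDl subr_ge0.
  apply: le_trans hV; rewrite mulr_natl -sumr_const; apply: ler_sum => a _.
  rewrite -real_normK ?realB// lerXn2r ?nnegrE//; exact: hS.
have h1 : #|S|%:R * V ^+ 2 <= 4 * \sum_t `|autocorr f t| ^+ 2.
  rewrite mulr_natl -sumr_const mulr_sumr.
  rewrite [leRHS](bigID (mem S)) /= -[leLHS]addr0 lerD//; last first.
    by apply: sumr_ge0 => a _; rewrite mulr_ge0// exprn_ge0.
  apply: ler_sum => t tS; rewrite real_normK//.
  have -> : 4 * autocorr f t ^+ 2 = (2 * autocorr f t) ^+ 2 by ring.
  rewrite lerXn2r ?nnegrE//; last exact: psiS.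
  exact: le_trans (psiS _ tS).
have fE : \sum_b `|fourier f b| ^+ 2 = N * V.
  rewrite parseval; congr (_ * _); apply: eq_bigr => a _.
  by rewrite real_normK.
have f00 : fourier f 0 = 0.
  rewrite -[RHS]f0; apply: eq_bigr => a _; rewrite dotvC dotv0 chr0; ring.
(* Parseval for the autocorrelation, whose transform is the square of [|fourier f b|]: in the fourth
   power, one square is bounded by its maximum and the other is summed by [fE]. *)
have h2 : N * \sum_t `|autocorr f t| ^+ 2 <= (N * p%:R * d) ^+ 2 * (N * V).
  rewrite -parseval -fE mulr_sumr; apply: ler_sum => b _.
  rewrite fourier_autocorr// (ger0_norm (exprn_ge0 _ _))// expr2.
  have [->|b0] := eqVneq b 0; first by rewrite f00 normr0 expr0n !mulr0.
  apply: ler_wpM2r; first exact: exprn_ge0.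
  have [t ht bt] := hd _ b0.
  rewrite lerXn2r ?nnegrE ?mulr_ge0 ?ler0n//.
  exact: norm_fourier_le ht bt.
have [->|Vn0] := eqVneq V 0.
  by rewrite mulr0 mulr_ge0// exprn_ge0// !mulr_ge0.
have {Vn0 V0}V0 : 0 < V by rewrite lt_neqAle eq_sym Vn0.
rewrite -(ler_pM2r V0) -(ler_pM2l N0).
have -> : N * (#|S|%:R * V * V) = N * (#|S|%:R * V ^+ 2) by ring.
apply: (@le_trans _ _ (N * (4 * \sum_t `|autocorr f t| ^+ 2))).
  by rewrite ler_pM2l.
have -> : N * (4 * (N * p%:R * d) ^+ 2 * V) = 4 * ((N * p%:R * d) ^+ 2 * (N * V)).
  ring.
by rewrite mulrCA ler_pM2l.
Qed.

End finite_fourier.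

(** Transfer to real-valued functions: the characters live in [R[i]], where the roots of unity
    exist. *)
Lemma near_period_count_real (R : rcfType) (p r : nat) (f : 'rV['F_p]_r -> R)
    (eta d : R) (S : {set 'rV['F_p]_r}) : prime p ->
  \sum_a f a = 0 -> 0 <= d -> 0 <= eta ->
  #|{: 'rV['F_p]_r}|%:R * eta ^+ 2 <= \sum_a f a ^+ 2 ->
  (forall t a, t \in S -> `|f (a + t) - f a| <= eta) ->
  (forall b, b != 0 ->
     exists2 t, forall a, `|f (a + t) - f a| <= d & dotv b t != 0) ->
  #|S|%:R * \sum_a f a ^+ 2 <= 4 * (#|{: 'rV['F_p]_r}|%:R * p%:R * d) ^+ 2.
Proof.
move=> p_pr f0 d0 e0 hV hS hd.
have [z zp z1] := @exists_unity_root p R[i] p_pr.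
pose g a : R[i] := (f a)%:C%C.
have gB a b : `|g a - g b| = (`|f a - f b|)%:C%C.
  by rewrite /g -rmorphB normc_def /= expr0n addr0 sqrtr_sqr.
have g2 : \sum_a g a ^+ 2 = (\sum_a f a ^+ 2)%:C%C.
  by rewrite rmorph_sum; apply: eq_bigr => a _; rewrite rmorphXn.
have := @near_period_count p r R[i] p_pr z zp z1 g eta%:C%C d%:C%C S.
rewrite g2 -!(rmorph_nat (real_complex R)) -!rmorphXn -!rmorphM -rmorphXn -rmorphM !lecR.
apply => //.
- by move=> a; rewrite complex_real.
- by rewrite /g -rmorph_sum f0.
- by move=> t a tS; rewrite gB lecR; exact: hS.
- by move=> b /hd[t ht bt]; exists t => // a; rewrite gB lecR.
Qed.

(** * Divisibility of compact connected groups *)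

(** Compactness in near-covering form, for the filter of finite sequences directed by inclusion. *)
Lemma finite_subcover (T : topologicalType) (V : T -> set T) :
  compact [set: T] -> (forall x, nbhs x (V x)) ->
  exists X : seq T, forall z, exists2 x, x \in X & V x z.
Proof.
move=> cT nV; have [ncT _] := compact_near_coveringP [set: T].
pose F := filter_from setT (fun X0 : seq T => [set X : seq T | {subset X0 <= X}]).
have FF : Filter F.
  apply: filter_from_filter; first by exists [::].
  move=> X Y _ _; exists (X ++ Y) => // Z /= XYZ.
  by split=> x xX; apply: XYZ; rewrite mem_cat xX ?orbT.
have [|X _ hX] := ncT cT _ F (fun X z => exists2 x, x \in X & V x z) FF.
  move=> x _; exists (V x, [set X : seq T | {subset [:: x] <= X}]).
    by split; [exact: nV|exists [:: x]].
  by move=> [z X] /= [Vz xX]; exists x => //; apply: xX; rewrite inE.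
by exists X => z; exact: (hX X (fun _ => id) z I).
Qed.

(** * Uniform structure of a compact abelian group *)

Section compact_group.
Variables (R : realType) (G : topologicalZmodType).
Hypothesis cG : compact [set: G].

Lemma mulrn_continuous n : continuous (fun x : G => x *+ n).
Proof.
elim: n => [|n IH] x; first exact: cst_continuous.
rewrite (_ : (fun x => _) = (fun x : G => x + x *+ n)); last first.
  by apply/funext => y; rewrite mulrS.
exact: (cvg_comp2 cvg_id (IH x) (@add_continuous G (x, x *+ n))).
Qed.

Lemma addr_continuous (a : G) : continuous (fun x : G => x + a).
Proof.
move=> x.
exact: (cvg_comp2 cvg_id (cvg_cst a) (@add_continuous G (x, a))).
Qed.

Lemma nbhs_subr (x : G) (U : set G) : nbhs 0 U -> nbhs x [set z | U (z - x)].
Proof. by rewrite -{1}(subrr x) => /(@addr_continuous (- x) x). Qed.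

Lemma nbhs_subl (x : G) (U : set G) : nbhs 0 U -> nbhs x [set z | U (x - z)].
Proof.
have : (fun z => x - z) @ x --> x - x.
  have cx : x @[_ --> nbhs x] --> x by exact: cvg_cst.
  exact: (@cvg_comp2 _ _ _ _ _ _ _ _ _ _ _ _ _ (fun a b : G => a - b) cx cvg_id (@sub_continuous G (x, x))).
by rewrite subrr => h /h.
Qed.

Lemma nbhs0_sub (U : set G) : nbhs 0 U ->
  exists2 W, nbhs 0 W & forall a b, W a -> W b -> U (a - b).
Proof.
rewrite -{1}(subr0 0) => /(@sub_continuous G (0, 0))[[A B] /= [nA nB] AB].
exists (A `&` B); first exact: filterI.
by move=> a b [Aa _] [_ Bb]; apply: (AB (a, b)).
Qed.

Lemma finite_net (U : set G) : nbhs 0 U ->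
  exists X : seq G, forall x, exists2 y, y \in X & U (y - x).
Proof.
move=> nU; have [X hX] := finite_subcover cG (fun x => nbhs_subl x nU).
by exists X => x; have [y yX Uyx] := hX x; exists y.
Qed.

(** Joint continuity of [h (x + u) - h x] at each [(x, 0)] is made uniform in [x] by near-covering
    compactness, applied to the filter of neighbourhoods of 0. *)
Lemma uniformly_continuous_addr (h : G -> R) : continuous h ->
  forall e : R, 0 < e -> exists2 U, nbhs (0 : G) U &
    forall x u, U u -> `|h (x + u) - h x| <= e.
Proof.
move=> ch e e0; have [ncG _] := compact_near_coveringP [set: G].
exists [set u | forall x, `|h (x + u) - h x| <= e]; last by move=> x u; exact.
suff: \forall u \near (0 : G), [set: G] `<=` (fun x => `|h (x + u) - h x| <= e).
  by apply: filterS => u hu x; exact: (hu x I).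
apply: (ncG cG G (nbhs 0) (fun u x => `|h (x + u) - h x| <= e)) => x _.
have c : (fun z : G * G => h (z.1 + z.2) - h z.1) z @[z --> (x, 0 : G)] --> 0.
  rewrite -[X in _ --> X](subrr (h x)) -{2}(addr0 x).
  apply: cvgB.
    apply: (@continuous_comp _ _ _ (fun z : G * G => z.1 + z.2)).
      exact: (@add_continuous G (x, 0)).
    exact: ch.
  apply: (@continuous_comp _ _ _ (fun z : G * G => z.1)); last exact: ch.
  exact: cvg_fst.
have /cvgrPdist_le/(_ e e0) := c.
apply: filterS => -[y u] /=; by rewrite sub0r normrN.
Qed.

End compact_group.

(** * Combinations with coefficients modulo [p] *)

Section mod_p_combinations.
Variables (G : zmodType) (p r : nat) (x : 'I_r -> G).
Hypothesis p_pr : prime p.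

Definition combination (a : 'rV['F_p]_r) : G := \sum_i x i *+ a 0%R i.

(** Coefficients are represented in [[0, p)]; the carries produced by reducing their sums make up
    the multiple of [p]. Thus [combination] is additive modulo p G only. *)
Lemma combinationD a b : exists w,
  combination (a + b) = combination a + combination b + w *+ p.
Proof.
exists (- \sum_i x i *+ ((a 0%R i + b 0%R i) %/ p)%N).
rewrite mulNrn -sumrMnl -!big_split -sumrB; apply: eq_bigr => i _ /=.
have -> : nat_of_ord ((a + b) 0 i) = ((a 0%R i + b 0%R i) %% p)%N.
  by rewrite mxE; congr (_ %% _)%N; exact: Fp_cast.
by apply/eqP; rewrite eq_sym subr_eq -mulrnA -!mulrnDr [X in _ == _ *+ X]addnC -divn_eq.
Qed.

Lemma combinationB a b : exists w,
  combination (a - b) = combination a - combination b + w *+ p.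
Proof.
have [w] := combinationD (a - b) b; rewrite subrK => ->; exists (- w).
by rewrite mulNrn addrAC addrK addrK.
Qed.

Lemma combination_delta i : combination (delta_mx 0 i) = x i.
Proof.
rewrite /combination (bigD1 i)//= mxE !eqxx big1 ?addr0 => [|j ji].
  have -> : ((1%:R : 'F_p) : nat) = 1%N by rewrite val_Fp_nat// modn_small ?prime_gt1.
  by rewrite mulr1n.
by rewrite mxE (negPf ji) andbF.
Qed.

End mod_p_combinations.

(** * Uniformly continuous functions invariant under p G are constant *)

Section periodic_function.
Variables (R : realType) (G : topologicalZmodType) (p : nat).
Hypotheses (cG : compact [set: G]) (connG : connected [set: G]).
Hypothesis p_pr : prime p.
Variable F : G -> R.
Hypothesis F_per : forall x w, F (x + w *+ p) = F x.
Hypothesis F_unif : forall e : R, 0 < e -> exists2 U, nbhs (0 : G) U &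
    forall x u, U u -> `|F (x + u) - F x| <= e.

Let phi r (x : 'I_r -> G) (a : 'rV['F_p]_r) := F (combination x a).

Let almost_periods r (x : 'I_r -> G) (e : R) : {set 'rV['F_p]_r} :=
  [set t | [forall a, `|phi x (a + t) - phi x a| <= e]]%SET.

Lemma almost_period_sub r (x : 'I_r -> G) (e : R) U a b y :
  (forall x u, U u -> `|F (x + u) - F x| <= e) ->
  U y -> combination x a - combination x b = y -> a - b \in almost_periods x e.
Proof.
move=> hU Uy aby; rewrite inE; apply/forallP => c; rewrite /phi.
have [w ->] := combinationD x p_pr c (a - b).
have [w' ->] := combinationB x p_pr a b.
by rewrite aby !addrA !F_per; exact: hU.
Qed.

(** Pigeonhole: assign each vector to a net point near its combination. Two vectors in the same
    class differ by an almost period, so no class is larger than the set of almost periods. The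
    number of classes is the size of the net, which depends on [e] but not on [r] or [x]. *)
Lemma almost_periods_dense (e : R) : 0 < e -> exists2 n : nat, (0 < n)%N &
  forall r (x : 'I_r -> G),
    (#|{: 'rV['F_p]_r}| <= n * #|almost_periods x e|)%N.
Proof.
move=> e0; have [U nU hU] := F_unif e0.
have [W nW hW] := nbhs0_sub nU.
have [X hX] := finite_net cG nW.
exists (size X) => [|r x].
  by case: (X) (hX 0) => // -[].
have hc (a : 'rV['F_p]_r) : exists k : 'I_(size X), W (nth 0 X k - combination x a).
  have [y yX Wy] := hX (combination x a).
  by rewrite -index_mem in yX; exists (Ordinal yX); rewrite /= nth_index// -index_mem.
have /choice[c {}hc] := hc.
rewrite -[leqLHS]sum1_card (partition_big c xpredT)//=.
apply: (@leq_trans (\sum_(k < size X) #|almost_periods x e|)%N); last first.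
  by rewrite sum_nat_const card_ord.
apply: leq_sum => k _; rewrite sum1_card.
have [b cb|c0] := pickP [pred a | c a == k]; last by rewrite eq_card0.
rewrite -(fintype.card_image (addIr (- b))); apply: subset_leq_card.
apply/fintype.subsetP => _ /fintype.imageP[a /eqP ca ->].
move: cb => /= /eqP cb.
apply: (almost_period_sub hU (hW _ _ (hc b) (hc a))).
by rewrite ca cb opprB [RHS]addrC addrA subrK.
Qed.

(** The family [x] consists of [y] followed by a fine net. If [b] killed every almost period, the
    value of [dotv b] at a combination near [z] would depend on [z] only and be locally constant,
    hence zero by connectedness; near [x i] it is [b 0 i], so [b] would vanish. *)
Lemma almost_periods_generate (e : R) (y : G) : 0 < e ->
  exists r (x : 'I_r -> G), (exists i, x i = y) /\
    forall b, b != 0 -> exists2 t, t \in almost_periods x e & dotv b t != 0.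
Proof.
move=> e0; have [U nU hU] := F_unif e0.
have [V nV hV] := nbhs0_sub nU.
have [W' nW' hW'] := nbhs0_sub nV.
pose W := W' `&` V; have nW : nbhs 0 W by exact: filterI.
have W0 : W 0 by exact: nbhs_singleton.
have [X hX] := finite_net cG nW.
pose x (i : 'I_(size (y :: X))) := nth 0 (y :: X) i.
exists (size (y :: X)), x; split; first by exists ord0.
move=> b b0; apply: contrapT => hb.
have {}hb t : t \in almost_periods x e -> dotv b t = 0.
  by move=> tS; apply/eqP; apply: contrapT => /negP bt; apply: hb; exists t.
have key a a' z z' : W (combination x a - z) -> W (combination x a' - z') ->
    W (z' - z) -> dotv b a = dotv b a'.
  move=> Wa Wa' Wz; apply/eqP; rewrite -subr_eq0 -dotvBr; apply/eqP/hb.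
  have := hV _ _ (hW' _ _ (proj1 Wa) (proj1 Wa')) (proj2 Wz).
  move=> /(almost_period_sub hU); apply.
  by rewrite !opprB [z' - _]addrC addrACA subrK addrK.
have near z : exists a, W (@combination _ p _ x a - z).
  have [y' y'X Wy'] := hX z.
  have y'yX : y' \in y :: X by rewrite inE y'X orbT.
  rewrite -index_mem in y'yX;
  have [a ay'] : exists a, @combination _ p _ x a = y'.
    exists (delta_mx 0 (Ordinal y'yX)); rewrite combination_delta//.
    by apply: nth_index; rewrite -index_mem.
  by exists a; rewrite ay'.
(* [dotv b] kills the almost periods, hence agrees at sums which are close in [G]. *)
pose C := [set z | exists2 a, W (combination x a - z) & dotv b a = 0].
have Wsub z : nbhs z [set z' | W (z' - z)] by exact: nbhs_subr.
have oC : open C.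
  rewrite openE => z [a Wa ba]; apply: filterS (Wsub z) => z' Wz.
  by have [a' Wa'] := near z'; exists a' => //; rewrite -(key _ _ _ _ Wa Wa' Wz).
have cC : closed C.
  rewrite -openC openE => z Cz; have [a Wa] := near z.
  apply: filterS (Wsub z) => z' Wz [a' Wa' ba'].
  by apply: Cz; exists a => //; rewrite (key _ _ _ _ Wa Wa' Wz).
have CT : C = setT.
  apply: connG; last 2 first.
  - by exists C => //; rewrite setTI.
  - by exists C => //; rewrite setTI.
  by exists 0, 0; rewrite ?dotv0// /combination big1 ?subr0// => i _; rewrite mxE.
case/eqP: b0; apply/rowP => i; rewrite mxE -dotv_delta.
have [a Wa <-] : C (x i) by rewrite CT.
apply: (key _ _ (x i) (x i)) => //; rewrite ?subrr//.
by rewrite combination_delta// subrr.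
Qed.

Lemma periodic_unif_cst y : F y = F 0.
Proof.
apply: contrapT => /eqP; rewrite -subr_eq0 -normr_gt0.
set D := `|_| => D0.
have [|n1 n10 hn1] := @almost_periods_dense (D / 4); first lra.
have n1R : 0 < n1%:R :> R by rewrite ltr0n.
(* The order of choices matters: [n1], [eta], [n2] and [d] are fixed before [r] and [x], which is
   possible because the densities do not depend on these. *)
pose eta := D / (4 * n1%:R).
have eta0 : 0 < eta by rewrite divr_gt0// mulr_gt0.
have [n2 n20 hn2] := almost_periods_dense eta0.
have n2R : 0 < n2%:R :> R by rewrite ltr0n.
have pR : 0 < p%:R :> R by rewrite ltr0n prime_gt0.
pose d := eta / (4 * n2%:R * p%:R).
have d0 : 0 < d by rewrite divr_gt0// !mulr_gt0.
have [r [x [[i xi] hgen]]] := almost_periods_generate y d0.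
set N := #|{: 'rV['F_p]_r}|%:R : R.
have N0 : 0 < N by rewrite ltr0n; apply/card_gt0P; exists 0.
pose m := (\sum_a phi x a) / N.
pose f a := phi x a - m.
have fB a b : f a - f b = phi x a - phi x b.
  by rewrite /f opprB addrA subrK.
have f0 : \sum_a f a = 0.
  rewrite big_split /= sumr_const mulNrn -mulr_natr /m divfK ?subrr//.
  by rewrite gt_eqF.
have phi0 : phi x 0 = F 0 by rewrite /phi /combination big1// => j _; rewrite mxE.
have phiy : phi x (delta_mx 0 i) = F y by rewrite /phi combination_delta// xi.
(* The values of [f] at 0 and at the basis vector representing [y] differ by [D]. *)
have [c hc] : exists c, D / 2 <= `|f c|.
  have : D <= `|f 0| + `|f (delta_mx 0 i)|.
    rewrite /D -phi0 -phiy -fB [leRHS]addrC; exact: ler_normB.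
  have [|h1 h2] := lerP (D / 2) `|f 0|; first by exists 0.
  by exists (delta_mx 0 i); lra.
(* At least [N / n1%:R] almost periods [t] keep [|f (c + t)|] above [D / 4], so the sum is at least
   N D^2 / (16 n1), while eta^2 = D^2 / (16 n1^2). *)
have hV : N * eta ^+ 2 <= \sum_a f a ^+ 2.
  set S := almost_periods x (D / 4).
  apply: (@le_trans _ _ (\sum_(t in S) f (c + t) ^+ 2)); last first.
    rewrite [leRHS](reindex_inj (addrI c)) /= [leRHS](bigID (mem S)) /= lerDl.
    by apply: sumr_ge0 => t _; exact: sqr_ge0.
  apply: (@le_trans _ _ (\sum_(t in S) (D / 4) ^+ 2)).
    rewrite sumr_const -[leRHS]mulr_natr.
    have := hn1 r x; rewrite -(ler_nat R) natrM -/N -/S => hS.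
    have e1 : eta ^+ 2 = (D / 4) ^+ 2 / n1%:R ^+ 2.
      by rewrite /eta; field; rewrite gt_eqF.
    have D4 : 0 <= (D / 4) ^+ 2 by exact: sqr_ge0.
    rewrite e1 mulrCA; apply: ler_wpM2l => //.
    rewrite ler_pdivrMr ?exprn_gt0// expr2 mulrA.
    apply: (le_trans hS); rewrite mulrC -[leLHS]mulr1.
    apply: ler_wpM2l; first by rewrite mulr_ge0// ler0n.
    by rewrite ler1n.
  apply: ler_sum => t; rewrite inE => /forallP/(_ c) hct.
  rewrite -[leRHS]real_normK ?num_real// lerXn2r ?nnegrE//; first lra.
  have : `|f c| <= `|f (c + t)| + `|f (c + t) - f c|.
    rewrite -{1}(subKr (f (c + t)) (f c)); exact: ler_normB.
  rewrite fB; lra.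
have hS t a : t \in almost_periods x eta -> `|f (a + t) - f a| <= eta.
  by rewrite inE fB => /forallP.
have hd b : b != 0 -> exists2 t, forall a, `|f (a + t) - f a| <= d & dotv b t != 0.
  move=> /hgen[t]; rewrite inE => /forallP ht bt; exists t => // a.
  by rewrite fB.
have := near_period_count_real p_pr f0 (ltW d0) (ltW eta0) hV hS hd.
have := hn2 r x; rewrite -(ler_nat R) natrM -/N; set s := #|_|%:R => hs h.
(* By the choice of [d] the right side equals the left side divided by [4 * n2%:R], which is absurd
   as the left side is positive. *)
have : N * (N * eta ^+ 2) <= n2%:R * (4 * (N * p%:R * d) ^+ 2).
  apply: (@le_trans _ _ (n2%:R * s * \sum_a f a ^+ 2)).
    by apply: ler_pM => //; apply: ltW; rewrite mulr_gt0// exprn_gt0.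
  by rewrite -mulrA ler_pM2l.
have -> : n2%:R * (4 * (N * p%:R * d) ^+ 2) = (N * (N * eta ^+ 2)) / (4 * n2%:R).
  by rewrite /d; field; rewrite !gt_eqF.
have h0 : 0 < N * (N * eta ^+ 2) by do 2 apply: mulr_gt0 => //; rewrite exprn_gt0.
rewrite ler_pdivlMr ?mulr_gt0// -[leRHS]mulr1 ler_pM2l//.
have : 1 <= n2%:R :> R by rewrite ler1n.
lra.
Qed.

End periodic_function.

(** * Division by positive integers *)

Section divisibility.
Variables (R : realType) (G : topologicalZmodType) (dist : G -> G -> R).
Hypotheses (hdist : metrized_by dist) (cG : compact [set: G]).
Hypothesis connG : connected [set: G].

Lemma dist_ge0 x y : 0 <= dist x y.
Proof.
have := dist_triangle hdist x y x; rewrite (dist_sym hdist y).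
have -> : dist x x = 0 by apply/(dist_eq0 hdist).
lra.
Qed.

Lemma distxx x : dist x x = 0.
Proof. exact/(dist_eq0 hdist). Qed.

Lemma dist_continuous x : continuous (dist x).
Proof.
move=> y; apply/(@cvgrPdist_lt _ _ _ (nbhs y)) => e e0.
apply/(nbhs_dist hdist); exists e => // z /= yz.
have := dist_triangle hdist x y z; have := dist_triangle hdist x z y.
rewrite (dist_sym hdist z y) => h1 h2.
by rewrite ltr_norml; apply/andP; split; lra.
Qed.

(** The distance [F z] from 0 to the coset z + p G is periodic and uniformly continuous, hence
    constant, equal to [F 0 = 0]. By compactness the infimum defining [F x] is attained, so 0 lies
    in x + p G. *)
Lemma prime_divisible p : prime p -> forall x : G, exists y, x = y *+ p.
Proof.
move=> p_pr x; apply: contrapT => hx.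
pose F z := inf (range (fun w => dist 0 (z + w *+ p))).
have lb z : has_lbound (range (fun w => dist 0 (z + w *+ p))).
  by exists 0 => _ [w _ <-]; exact: dist_ge0.
have ne z : range (fun w => dist 0 (z + w *+ p)) !=set0.
  by exists (dist 0 (z + 0 *+ p)), 0.
have F_per z w : F (z + w *+ p) = F z.
  rewrite /F; congr inf; apply/seteqP; split => _ [v _ <-].
    by exists (w + v) => //; rewrite mulrnDl addrA.
  by exists (v - w) => //; rewrite mulrnBl addrA addrAC addrK.
have F_unif (e : R) : 0 < e -> exists2 U, nbhs (0 : G) U &
    forall z u, U u -> `|F (z + u) - F z| <= e.
  move=> /(uniformly_continuous_addr cG (@dist_continuous 0))[U nU hU].
  have le_inf z z' : (forall w, dist 0 (z + w *+ p) <= dist 0 (z' + w *+ p) + e) ->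
      F z - e <= F z'.
    move=> h; apply: lb_le_inf => // _ [w _ <-]; rewrite lerBlDr.
    by apply: le_trans (h w); apply: ge_inf => //; exists w.
  exists U => // z u Uu; rewrite ler_distl.
  have hw w : `|dist 0 (z + u + w *+ p) - dist 0 (z + w *+ p)| <= e.
    by rewrite addrAC; exact: hU.
  rewrite le_inf/= => [|w]; last first.
    by have := hw w; rewrite ler_distl => /andP[+ _]; rewrite lerBlDr.
  rewrite -lerBlDr le_inf// => w.
  by have := hw w; rewrite ler_distl => /andP[_].
have G0 : [set: G] !=set0 by exists 0.
have [|c _ hc] := @compact_EVT_min _ _ (fun w => dist 0 (x + w *+ p)) _ G0 cG.
  apply: continuous_subspaceT => w.
  apply: (@continuous_comp _ _ _ (fun w => x + w *+ p)).
    rewrite (_ : (fun w => _) = (fun w : G => w *+ p + x)); last first.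
      by apply/funext => v; rewrite addrC.
    apply: (@continuous_comp _ _ _ (fun w : G => w *+ p) (fun v => v + x)).
      exact: mulrn_continuous.
    exact: addr_continuous.
  exact: dist_continuous.
have F0 : F 0 = 0.
  apply/eqP; rewrite eq_le lb_le_inf// ?andbT => [|_ [w _ <-]]; last exact: dist_ge0.
  by apply: ge_inf => //; exists 0 => //; rewrite mul0rn addr0 distxx.
have : 0 < F x.
  apply: (@lt_le_trans _ _ (dist 0 (x + c *+ p))).
    rewrite lt_neqAle dist_ge0 andbT eq_sym; apply/eqP => /(dist_eq0 hdist) xc.
    by apply: hx; exists (- c); rewrite mulNrn -[LHS](addrK (c *+ p)) -xc sub0r.
  by apply: lb_le_inf => // _ [w _ <-]; apply: hc; rewrite inE.
by rewrite (periodic_unif_cst cG connG p_pr F_per F_unif x) F0 ltxx.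
Qed.

Lemma divisible n : (0 < n)%N -> forall x : G, exists y, x = y *+ n.
Proof.
elim/ltn_ind: n => n IH n0 x.
have [->|n1] := eqVneq n 1%N; first by exists x.
have n_gt1 : (1 < n)%N by lia.
have /dvdnP[q nq] := pdiv_dvd n.
have pp := pdiv_prime n_gt1.
have [y xy] := prime_divisible pp x.
have p1 := prime_gt1 pp.
have q0 : (0 < q)%N by nia.
have [|z yz] := IH q _ q0 y; first by nia.
by exists z; rewrite xy yz [in RHS]nq mulrnA.
Qed.

End divisibility.

(** * Independence along orbits *)

Lemma measurable_continuous_comp (R : realType) d (T : measurableType d)
    (S : topologicalZmodType) (f : T -> S) (h : S -> R) :
  measurable_fun setT (f : T -> borel S) -> continuous h ->
  measurable_fun setT (h \o f).
Proof.
move=> mf ch mT.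
apply: (measurability _ (RGenOpens.measurableE R)) => //.
move=> _ [_ [a [b ->]] <-]; rewrite setTI comp_preimage -[_ @^-1` _]setTI.
apply: mf => //; apply: sub_sigma_algebra => /=.
by move/continuousP: ch; apply; exact: interval_open.
Qed.

Lemma continuous_measurable (S K : topologicalZmodType) (f : S -> K) :
  continuous f -> measurable_fun setT (f : borel S -> borel K).
Proof.
move=> cf.
refine (@measurability _ _ (borel S) (borel K) setT f
  (@open (pointed_at0 K)) erefl _).
move=> _ [A oA <-]; rewrite setTI; apply: sub_sigma_algebra => /=.
by move/continuousP: cf; exact.
Qed.

Lemma continuous_measurable_real (R : realType) (S : topologicalZmodType)
  (f : S -> R) : continuous f -> measurable_fun setT (f : borel S -> R).
Proof.
move=> cf; exact: (@measurable_continuous_comp _ _ (borel S) S id).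
Qed.

(** * Haar measure along the orbits *)

Section haar.
Variables (R : realType) (G : topologicalZmodType) (dist : G -> G -> R).
Hypotheses (hdist : metrized_by dist) (cG : compact [set: G]).

(** The source carries the product of the Borel sigma-algebras, so an open set of G x G has to be a
    countable union of measurable rectangles. Finite nets at the scales [n.+1%:R^-1] supply the
    balls. *)
Lemma continuous_measurable_prod (f : G * G -> G) :
  continuous f -> measurable_fun setT (f : borel G * borel G -> borel G).
Proof.
move=> cf.
refine (@measurability _ _ (borel G * borel G)%type (borel G) setT f
  (@open (pointed_at0 G)) erefl _).
move=> _ [A oA <-]; rewrite setTI.
pose V n x := [set y | dist x y < n.+1%:R^-1].
have nV n x : nbhs x (V n x).
  by apply/(nbhs_dist hdist); exists n.+1%:R^-1 => //; rewrite invr_gt0.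
have /choice[X hX] n := finite_subcover cG (nV n).
pose D n := [set yy : G * G | [/\ yy.1 \in X n, yy.2 \in X n &
   V n yy.1 `*` V n yy.2 `<=` f @^-1` A]].
have -> : f @^-1` A = \bigcup_n \bigcup_(yy in D n) (V n yy.1 `*` V n yy.2).
  apply/seteqP; split => [[z1 z2] Az|]; last first.
    by move=> z [n _ [yy [_ _ +]]]; exact.
  have : nbhs (z1, z2) (f @^-1` A).
    by apply: open_nbhs_nbhs; split => //; move/continuousP: cf; exact.
  move=> [[B1 B2] /= [/(nbhs_dist hdist)[e1 e10 B1e]]].
  move=> /(nbhs_dist hdist)[e2 e20 B2e] B12.
  (* The factor 2 is there because two points of a ball centred at a net point may be at almost
     twice its radius from each other. *)
  have [n hn] : exists n, 2 * n.+1%:R^-1 < Num.min e1 e2.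
    have e0 : 0 < Num.min e1 e2 / 2 by rewrite divr_gt0// lt_min e10.
    have [n _ /(_ n (leqnn n)) hn] := near_infty_natSinv_lt (PosNum e0).
    by exists n; rewrite mulrC -ltr_pdivlMr.
  have [y1 y1X Vy1] := hX n z1; have [y2 y2X Vy2] := hX n z2.
  exists n => //; exists (y1, y2) => //; split => //= -[w1 w2] /= [Vw1 Vw2].
  have near y z w e : V n y z -> V n y w -> 2 * n.+1%:R^-1 < e -> dist z w < e.
    rewrite /V /= => h1 h2 h3; have := dist_triangle hdist z y w.
    rewrite (dist_sym hdist z y); move: h1 h2 h3; set c := _^-1; lra.
  move: hn; rewrite lt_min => /andP[hn1 hn2].
  apply: (B12 (w1, w2)); split => /=.
    by apply: B1e; exact: (near y1 _ _ _ Vy1 Vw1 hn1).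
  by apply: B2e; exact: (near y2 _ _ _ Vy2 Vw2 hn2).
apply: bigcup_measurable => n _; apply: fin_bigcup_measurable => [|yy _].
  apply: (@sub_finite_set _ _ ([set` X n] `*` [set` X n])).
    by move=> [y1 y2] [/= ? ? _].
  by apply: finite_setX; exact: finite_seq.
have mV y : measurable (V n y : set (borel G)).
  have := continuous_measurable_real (@dist_continuous _ _ _ hdist y).
  move=> /(_ measurableT `]-oo, n.+1%:R^-1[%classic); rewrite setTI => h.
  have -> : V n y = dist y @^-1` `]-oo, n.+1%:R^-1[%classic.
    by apply/seteqP; split => z /=; rewrite in_itv.
  exact: h.
exact: measurableX.
Qed.

Lemma orbit_continuous k : continuous (fun ux : G * G => ux.2 + ux.1 *+ k).
Proof.
move=> [u x].
have c1 : {for (u, x), continuous (fun ux : G * G => ux.1 *+ k)}.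
  apply: (@continuous_comp _ _ _ (fun ux : G * G => ux.1) (fun v => v *+ k)).
    exact: cvg_fst.
  exact: mulrn_continuous.
have c2 : (fun ux : G * G => ux.2) @ (u, x) --> x by exact: cvg_snd.
exact: (@cvg_comp2 _ _ _ _ _ _ _ _ _ _ _ _ _ (fun a b : G => a + b) c2 c1 (@add_continuous G (x, u *+ k))).
Qed.

Lemma measurable_orbit k :
  measurable_fun setT (fun ux : borel G * borel G => (ux.2 + ux.1 *+ k : borel G)).
Proof. exact: continuous_measurable_prod (@orbit_continuous k). Qed.

Variable mu : probability (borel G) R.
Hypothesis haar_mu : haar_measure mu.

Lemma measurable_translate (a : G) :
  measurable_fun setT (fun x : borel G => (x + a : borel G)).
Proof. exact: continuous_measurable (@addr_continuous G a). Qed.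

Lemma haar_preimage (a : G) (A : set (borel G)) : measurable A ->
  mu ((fun x : borel G => (x + a : borel G)) @^-1` A) = mu A.
Proof.
move=> mA; rewrite -(haar_mu (- a) mA); congr (mu _).
apply/seteqP; split => [x Ax|_ [y Ay <-]].
  by exists (x + a) => //; rewrite addrC addrK.
by rewrite /= [- a + y]addrC subrK.
Qed.

Lemma ge0_integral_translate (a : G) (g : borel G -> \bar R) :
  measurable_fun setT g -> (forall x, 0 <= g x)%E ->
  (\int[mu]_x g (x + a)%R = \int[mu]_x g x)%E.
Proof.
move=> mg g0.
have := @ge0_integral_pushforward _ _ _ _ _ _ (measurable_translate a) mu setT g
  measurableT mg (fun x _ => g0 x).
rewrite preimage_setT => <-; apply: eq_measure_integral => [|? A mA _]; first exact: measurable_translate.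
exact: (haar_preimage a mA).
Qed.

(** Tonelli, then for each fixed [u] invariance under translation by [u *+ k]. *)
Lemma ge0_integral_orbit k (g : borel G -> \bar R) :
  measurable_fun setT g -> (forall x, 0 <= g x)%E ->
  (\int[mu \x mu]_ux g (ux.2 + ux.1 *+ k)%R = \int[mu]_x g x)%E.
Proof.
move=> mg g0; rewrite fubini_tonelli1 => [||ux//]; last first.
  exact: (measurableT_comp mg (measurable_orbit k)).
under eq_integral do rewrite /fubini_F /= ge0_integral_translate//.
by rewrite integral_cst// -[RHS]mule1; congr (_ * _)%E; exact: probability_setT.
Qed.

Hypothesis connG : connected [set: G].

(** Integrate [g (x + y *+ m)] over both variables. For [x] fixed, write [x = b *+ m] by
    divisibility: the argument is [(y + b) *+ m], and translation invariance in [y] removes [b]. *)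
Lemma ge0_integral_mulrn m (g : borel G -> \bar R) : (0 < m)%N ->
  measurable_fun setT g -> (forall x, 0 <= g x)%E ->
  (\int[mu]_x g (x *+ m)%R = \int[mu]_x g x)%E.
Proof.
move=> m0 mg g0; rewrite -(ge0_integral_orbit m mg g0).
rewrite fubini_tonelli2 => [||ux//]; last first.
  exact: (measurableT_comp mg (measurable_orbit m)).
have mgm : measurable_fun setT (fun x : borel G => g (x *+ m)).
  by apply: (measurableT_comp mg (continuous_measurable (@mulrn_continuous G m))).
transitivity (\int[mu]_y (\int[mu]_x g (x *+ m)%R))%E.
  by rewrite integral_cst// -[LHS]mule1; congr (_ * _)%E; exact/esym/probability_setT.
apply: eq_integral => x _; rewrite /fubini_G /=.
have [b ->] := divisible hdist cG connG m0 x.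
by rewrite -(ge0_integral_translate b mgm)//; apply: eq_integral => y _; rewrite mulrnDl addrC.
Qed.

Lemma measurable_orbit2 k l : measurable_fun setT
  (fun ux : borel G * borel G =>
    ((ux.2 + ux.1 *+ k, ux.2 + ux.1 *+ l) : borel G * borel G)).
Proof. by apply/measurable_fun_pairP; split; exact: measurable_orbit. Qed.

(** Pairwise independence. For fixed [u], translation turns the pair into [(x, x + u *+ (l - k))];
    for fixed [x], [u *+ (l - k)] is Haar distributed, and a last translation by [x] makes the
    second coordinate free. *)
Lemma ge0_integral_orbit2 k l (h : borel G * borel G -> \bar R) : (k < l)%N ->
  measurable_fun setT h -> (forall z, 0 <= h z)%E ->
  (\int[mu \x mu]_ux h (ux.2 + ux.1 *+ k, ux.2 + ux.1 *+ l)%R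
   = \int[mu \x mu]_z h z)%E.
Proof.
move=> kl mh h0.
have mhx x : measurable_fun setT (fun y => h (x, y)).
  by apply: (measurableT_comp mh); exact: measurable_pair1.
have mid : measurable_fun setT (fun ux : borel G * borel G =>
    ((ux.2, ux.2 + ux.1 *+ (l - k)) : borel G * borel G)).
  apply/measurable_fun_pairP; split; first exact: measurable_snd.
  exact: measurable_orbit.
transitivity (\int[mu \x mu]_ux h (ux.2, ux.2 + ux.1 *+ (l - k))%R)%E.
  rewrite fubini_tonelli1; [|exact: measurableT_comp mh (measurable_orbit2 k l)|by move=> ?].
  rewrite fubini_tonelli1; [|exact: measurableT_comp mh mid|by move=> ?].
  apply: eq_integral => u _; rewrite /fubini_F/=.
  rewrite -(@ge0_integral_translate (u *+ k) (fun x => h (x, x + u *+ (l - k))%R))//.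
    by apply: eq_integral => x _; rewrite -addrA -mulrnDr subnKC// ltnW.
  apply: (measurableT_comp mh); apply/measurable_fun_pairP; split.
    exact: measurable_id.
  exact: (measurable_translate (u *+ (l - k))).
rewrite fubini_tonelli2; [|exact: measurableT_comp mh mid|by move=> ?].
rewrite fubini_tonelli1//.
apply: eq_integral => x _; rewrite /fubini_F/fubini_G/=.
rewrite (@ge0_integral_mulrn (l - k) (fun y => h (x, x + y)%R)) ?subn_gt0//.
  rewrite -(@ge0_integral_translate x (fun y => h (x, y)))//.
  by apply: eq_integral => y _; rewrite addrC.
have mx : measurable_fun setT (fun y : borel G => (x + y : borel G)).
  rewrite (_ : (fun y => _) = (fun y : borel G => (y + x : borel G))).
    exact: (measurable_translate x).
  by apply/funext => y; rewrite addrC.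
exact: (measurableT_comp (mhx x) mx).
Qed.

Lemma probability_orbit2 k l (A : set (borel G * borel G)) : (k < l)%N ->
  measurable A ->
  (mu \x mu)%E ((fun ux : borel G * borel G =>
    (ux.2 + ux.1 *+ k, ux.2 + ux.1 *+ l)) @^-1` A) = (mu \x mu)%E A.
Proof.
move=> kl mA.
have mA' : measurable ((fun ux : borel G * borel G =>
    (ux.2 + ux.1 *+ k, ux.2 + ux.1 *+ l)) @^-1` A).
  by rewrite -[_ @^-1` _]setTI; exact: measurable_orbit2.
have h : (\int[mu \x mu]_ux (\1_A (ux.2 + ux.1 *+ k, ux.2 + ux.1 *+ l)%R)%:E =
    \int[mu \x mu]_z (\1_A z)%:E)%E.
  apply: (@ge0_integral_orbit2 k l (fun z => (\1_A z)%:E)) => //.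
  by apply: measurableT_comp => //; exact: measurable_indic.
have : (\int[mu \x mu]_z (\1_A z)%:E = (mu \x mu) A)%E.
  by rewrite integral_indic// setIT.
rewrite -h => <-.
by rewrite -[in LHS](setIT (_ @^-1` _)) -integral_indic.
Qed.

End haar.

(** * The strong law *)

Section maximal_inequality.
Variables (R : realFieldType) (X : nat -> R).

(** Squares of the single terms and of the sums over the left halves of all dyadic blocks of [a, a +
    2^j): these are the pieces from which every initial segment is assembled. *)
Fixpoint dyadic_energy (j a : nat) : R :=
  match j with
  | 0%N => X a ^+ 2
  | j.+1 => dyadic_energy j a + dyadic_energy j (a + 2 ^ j) +
      (\sum_(a <= k < a + 2 ^ j) X k) ^+ 2
  end.

Lemma dyadic_energy_ge0 j a : 0 <= dyadic_energy j a.
Proof. by elim: j a => [|j IH] a /=; rewrite ?addr_ge0// ?sqr_ge0. Qed.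

(** An initial segment is a disjoint union of at most [j.+1] pieces, and Cauchy-Schwarz gives the
    factor. The right side does not depend on [n], so this controls the maximum of the partial
    sums. *)
Lemma sqr_sum_le_dyadic_energy j a n : (n <= 2 ^ j)%N ->
  (\sum_(a <= k < a + n) X k) ^+ 2 <= j.+1%:R * dyadic_energy j a.
Proof.
elim: j a n => [|j IH] a n hn.
  case: n hn => [|[|//]] _; last by rewrite addn1 big_nat1 mul1r.
  by rewrite addn0 big_geq// expr0n mul1r sqr_ge0.
rewrite [dyadic_energy _ _]/=; set B := \sum_(a <= k < a + 2 ^ j) X k.
have E0 := dyadic_energy_ge0 j a; have E1 := dyadic_energy_ge0 j (a + 2 ^ j).
have j0 : 0 <= j%:R :> R by exact: ler0n.
have hS : j.+2%:R = j%:R + 2 :> R by rewrite -addn2 natrD.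
have hS1 : j.+1%:R = j%:R + 1 :> R by rewrite -addn1 natrD.
have [nj|jn] := leqP n (2 ^ j).
  apply: le_trans (IH _ _ nj) _; rewrite hS hS1.
  have := sqr_ge0 B; set u := dyadic_energy j a in E0 *.
  set v := dyadic_energy j _ in E1 *; set b := B ^+ 2 => b0.
  rewrite -subr_ge0.
  have -> : (j%:R + 2) * (u + v + b) - (j%:R + 1) * u =
    u + (j%:R + 2) * (v + b) by ring.
  by rewrite addr_ge0// mulr_ge0// ?addr_ge0.
have nE : (n = 2 ^ j + (n - 2 ^ j))%N by rewrite subnKC// ltnW.
have a2 : (a + 2 ^ j <= a + n)%N by rewrite leq_add2l ltnW.
have hn' : (n - 2 ^ j <= 2 ^ j)%N by rewrite leq_subLR addnn -mul2n -expnS.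
have := IH (a + 2 ^ j)%N _ hn'; rewrite -addnA -nE.
rewrite [in X in _ -> X](big_cat_nat (leq_addr (2 ^ j) a) a2)/= -/B.
set C := \sum_(a + 2 ^ j <= k < a + n) X k.
set u := dyadic_energy j a in E0 *; set v := dyadic_energy j _ in E1 *.
rewrite hS hS1 => hC.
set t := j%:R + 1 in hC *; have t0 : 0 < t by rewrite /t -hS1 ltr0n.
have -> : j%:R + 2 = t + 1 by rewrite /t; ring.
(* (B + C)^2 <= (t + 1) B^2 + (1 + 1/t) C^2 *)
rewrite -(ler_pM2l t0).
have h : t * (B + C) ^+ 2 <= (t + 1) * (t * B ^+ 2 + C ^+ 2).
  rewrite -subr_ge0; have -> : (t + 1) * (t * B ^+ 2 + C ^+ 2) - t * (B + C) ^+ 2 =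
    (t * B - C) ^+ 2 by ring.
  exact: sqr_ge0.
apply: le_trans h _; rewrite [leRHS]mulrCA (ler_pM2l (addr_gt0 t0 ltr01)).
rewrite -!addrA !mulrDr; have : 0 <= t * u by rewrite mulr_ge0// ltW.
move: hC; set p := t * v; set q := t * B ^+ 2; lra.
Qed.

End maximal_inequality.

(** Each of the [n.+1] terms of the geometric sum is at least [w ^+ n]. *)
Lemma natr_expr_bound (R : realFieldType) (w : R) n : 0 <= w -> w < 1 ->
  (1 - w) * (n.+1%:R * w ^+ n) <= 1.
Proof.
move=> w0 w1; apply: (@le_trans _ _ ((1 - w) * \sum_(i < n.+1) w ^+ i)).
  apply: ler_wpM2l; first by rewrite subr_ge0 ltW.
  rewrite mulr_natl -[in X in X <= _](card_ord n.+1) -sumr_const.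
  apply: ler_sum => i _; apply: ler_wiXn2l => //; first exact: ltW.
  by rewrite -ltnS.
by rewrite -opprB mulNr -subrX1 opprB gerBl exprn_ge0.
Qed.

Lemma nneseries_sqr_geometric_lty (R : realType) (q : R) : 0 <= q -> q < 1 ->
  (\sum_(0 <= j <oo) (j.+1%:R ^+ 2 * q ^+ j)%:E < +oo)%E.
Proof.
move=> q0 q1; pose w := Num.sqrt (Num.sqrt q).
have w0 : 0 <= w by exact: sqrtr_ge0.
have wq : w ^+ 4 = q.
  by rewrite (exprM w 2 2) !sqr_sqrtr ?sqrtr_ge0.
have w1 : w < 1.
  by rewrite ltNge; apply/negP => /(exprn_ege1 4); rewrite wq leNgt q1.
have hw := natr_expr_bound _ w0 w1.
pose C := ((1 - w) ^+ 2)^-1; have w1' : 0 < 1 - w by rewrite subr_gt0.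
have w21 : w ^+ 2 < 1 by rewrite expr_lt1.
apply: (@le_lt_trans _ _ (C / (1 - w ^+ 2))%:E); last exact: ltry.
apply: lime_le.
  by apply: is_cvg_nneseries => j _ _; rewrite lee_fin mulr_ge0 ?sqr_ge0// exprn_ge0.
apply: nearW => n; rewrite sumEFin lee_fin ler_pdivlMr ?subr_gt0//.
apply: (@le_trans _ _ (C * (\sum_(0 <= j < n) (w ^+ 2) ^+ j) * (1 - w ^+ 2))).
  apply: ler_wpM2r; first by rewrite subr_ge0 ltW.
  rewrite mulr_sumr; apply: ler_sum => j _.
  rewrite /C ler_pdivlMl ?exprn_gt0//.
  have -> : (1 - w) ^+ 2 * (j.+1%:R ^+ 2 * q ^+ j) =
    ((1 - w) * (j.+1%:R * w ^+ j)) ^+ 2 * (w ^+ 2) ^+ j.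
    rewrite -wq -!exprM !exprMn -!exprM.
    have -> : (4 * j = j * 2 + 2 * j)%N by lia.
    by rewrite exprD; ring.
  rewrite -[leRHS]mul1r; apply: ler_wpM2r; first by rewrite exprn_ge0// exprn_ge0.
  by rewrite exprn_ile1// ?hw// !mulr_ge0 ?exprn_ge0// ltW.
rewrite -mulrA -[leRHS]mulr1; apply: ler_wpM2l.
  by rewrite invr_ge0 sqr_ge0.
rewrite big_mkord mulrC -opprB mulNr -subrX1 opprB gerBl exprn_ge0//.
exact: exprn_ge0.
Qed.

(** * Orthogonality of the values along an orbit *)

Section orbit_sums.
Variables (R : realType) (G : topologicalZmodType) (dist : G -> G -> R).
Hypotheses (hdist : metrized_by dist) (cG : compact [set: G]).
Hypothesis connG : connected [set: G].
Variable mu : probability (borel G) R.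
Hypothesis haar_mu : haar_measure mu.
Variable f : G -> R.
Hypotheses (mf : measurable_fun setT (f : borel G -> R))
  (f2 : (\int[mu]_x ((f x) ^+ 2)%:E < +oo)%E).

Let X (ux : borel G * borel G) k := f (ux.2 + ux.1 *+ k).
Let V := fine (\int[mu]_x ((f x) ^+ 2)%:E)%E.

Let VE : (\int[mu]_x ((f x) ^+ 2)%:E)%E = V%:E.
Proof.
rewrite fineK// ge0_fin_numE//; apply: integral_ge0 => x _.
by rewrite lee_fin sqr_ge0.
Qed.

Let V_ge0 : 0 <= V.
Proof. by apply/fine_ge0/integral_ge0 => x _; rewrite lee_fin sqr_ge0. Qed.

Let mX k : measurable_fun setT (X ^~ k).
Proof. exact: measurableT_comp mf (measurable_orbit hdist cG k). Qed.

Let mf2 : measurable_fun setT (fun x : borel G => ((f x) ^+ 2)%:E).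
Proof. by apply: measurableT_comp => //; exact: measurable_funX. Qed.

Lemma integral_sqr_orbit k :
  (\int[mu \x mu]_ux ((X ux k) ^+ 2)%:E)%E = V%:E.
Proof.
rewrite -VE -(ge0_integral_orbit hdist cG haar_mu k mf2)//.
by move=> x; rewrite lee_fin sqr_ge0.
Qed.

Lemma integrable_sqr_orbit k :
  (mu \x mu)%E.-integrable setT (fun ux => ((X ux k) ^+ 2)%:E).
Proof.
apply/integrableP; split.
  by apply: measurableT_comp => //; exact: measurable_funX.
under eq_integral do rewrite gee0_abs ?lee_fin ?sqr_ge0//.
by rewrite integral_sqr_orbit ltry.
Qed.

Lemma integrable_mul_orbit k l :
  (mu \x mu)%E.-integrable setT (fun ux => (X ux k * X ux l)%:E).
Proof.
apply: (le_integrable measurableT) (integrableD measurableT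
  (integrable_sqr_orbit k) (integrable_sqr_orbit l)).
  by apply: measurableT_comp => //; exact: measurable_funM.
move=> ux _; rewrite -EFinD !abse_EFin lee_fin.
set x := X ux k; set y := X ux l.
rewrite [leRHS]ger0_norm ?addr_ge0 ?sqr_ge0// ler_norml.
have := sqr_ge0 (x + y); have := sqr_ge0 (x - y).
have := sqr_ge0 x; have := sqr_ge0 y.
rewrite sqrrB sqrrD; set a := x ^+ 2; set b := y ^+ 2; set c := x * y.
by move=> *; apply/andP; split; lra.
Qed.

Lemma integrable_of_sqr : mu.-integrable setT (EFin \o f).
Proof.
have i2 : mu.-integrable setT (fun x => ((f x) ^+ 2)%:E).
  apply/integrableP; split => //.
  by under eq_integral do rewrite gee0_abs ?lee_fin ?sqr_ge0//.
have i1 : mu.-integrable setT (cst 1%:E) by exact: finite_measure_integrable_cst.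
apply: (le_integrable measurableT) (integrableD measurableT i1 i2).
  exact: measurableT_comp.
move=> x _; rewrite -EFinD !abse_EFin lee_fin [leRHS]ger0_norm ?addr_ge0 ?sqr_ge0//.
rewrite ler_norml; have := sqr_ge0 (f x - 1); have := sqr_ge0 (f x + 1).
rewrite sqrrB sqrrD; set a := f x ^+ 2; have : 0 <= a by exact: sqr_ge0.
by move=> *; apply/andP; split; lra.
Qed.

Hypothesis f0 : (\int[mu]_x (f x)%:E = 0)%E.

(** By independence the integral is the square of the mean of [f]. The integrand is signed, so the
    change of variables goes through the image measure and needs integrability. *)
Lemma orbit_orthogonal k l : (k < l)%N ->
  (\int[mu \x mu]_ux (X ux k * X ux l)%:E = 0)%E.
Proof.
move=> kl; pose h (z : borel G * borel G) := (f z.1 * f z.2)%:E.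
have mh : measurable_fun setT h.
  apply: measurableT_comp => //; apply: measurable_funM.
    exact: measurableT_comp mf measurable_fst.
  exact: measurableT_comp mf measurable_snd.
(* Integrability on the product is read off from integrability along the orbit, as the absolute
   value has the same integral on both sides. *)
have ih : (mu \x mu)%E.-integrable setT h.
  apply/integrableP; split => //.
  rewrite -(ge0_integral_orbit2 hdist cG haar_mu connG kl)//; last first.
    exact: measurableT_comp.
  by have /integrableP[] := integrable_mul_orbit k l.
transitivity (\int[mu \x mu]_z h z)%E.
  have mo2 := measurable_orbit2 hdist cG k l.
  pose phi (ux : borel G * borel G) : borel G * borel G :=
    (ux.2 + ux.1 *+ k, ux.2 + ux.1 *+ l).
  transitivity (\int[pushforward (mu \x mu) phi]_z h z)%E.
    rewrite integral_pushforward// preimage_setT.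
    exact: (integrable_mul_orbit k l).
  apply: eq_measure_integral => A mA _; exact: (probability_orbit2 hdist cG haar_mu connG kl mA).
rewrite -integral12_prod_meas1//; apply: integral0_eq => x _.
rewrite /fubini_F /h /=; under eq_integral do rewrite EFinM.
by rewrite integralZl ?f0 ?mule0//; exact: integrable_of_sqr.
Qed.

Lemma integral_sqr_sum_orbit a n :
  (\int[mu \x mu]_ux ((\sum_(a <= k < a + n) X ux k) ^+ 2)%:E)%E = (n%:R * V)%:E.
Proof.
transitivity (\int[mu \x mu]_ux \sum_(i < n) \sum_(j < n)
    (X ux (i + a) * X ux (j + a))%:E)%E.
  apply: eq_integral => ux _.
  rewrite (_ : \sum_(a <= k < a + n) X ux k = \sum_(i < n) X ux (i + a)).
    rewrite expr2 big_distrlr/= -sumEFin; apply: eq_bigr => i _.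
    by rewrite sumEFin.
  by rewrite -{1}(add0n a) big_addn addKn big_mkord.
rewrite integral_sum//; last first.
  by move=> i; apply: integrable_sum => // j _; exact: integrable_mul_orbit.
rewrite (eq_bigr (fun=> V%:E)) => [|i _].
  by rewrite sumEFin sumr_const card_ord mulr_natl.
rewrite integral_sum//; last by move=> j; exact: integrable_mul_orbit.
rewrite (bigD1 i)//= big1 ?adde0 => [|j ji].
  by rewrite -(integral_sqr_orbit (i + a)); apply: eq_integral => ux _; rewrite expr2.
have [ij|ji'] := ltnP i j; first by rewrite orbit_orthogonal ?ltn_add2r.
under eq_integral do rewrite mulrC.
by rewrite orbit_orthogonal// ltn_add2r; move: ji; rewrite -val_eqE /=; lia.
Qed.

Lemma measurable_dyadic_energy j a :
  measurable_fun setT (fun ux => dyadic_energy (X ux) j a).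
Proof.
elim: j a => [|j IH] a /=; first exact: measurable_funX.
apply: measurable_funD; first exact: measurable_funD.
by apply: measurable_funX; exact: measurable_sum.
Qed.

(** By orthogonality, a block sum has mean square [V] times the length of the block. The blocks of
    one size are disjoint, so each of the [j.+1] sizes contributes at most [2 ^+ j * V]. *)
Lemma integral_dyadic_energy j a :
  (\int[mu \x mu]_ux (dyadic_energy (X ux) j a)%:E <=
   (j.+1%:R * 2 ^+ j * V)%:E)%E.
Proof.
elim: j a => [|j IH] a.
  by rewrite integral_sqr_orbit mul1r expr0 mul1r.
have mE b := measurable_dyadic_energy j b.
have mS : measurable_fun setT (fun ux => \sum_(a <= k < a + 2 ^ j) X ux k).
  exact: measurable_sum.
rewrite /=; under eq_integral do rewrite !EFinD.
rewrite ge0_integralD//; last 4 first.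
- by move=> ux _; rewrite -EFinD lee_fin addr_ge0 ?dyadic_energy_ge0.
- by apply: emeasurable_funD; exact: measurableT_comp.
- by move=> ux _; rewrite lee_fin sqr_ge0.
- by apply: measurableT_comp => //; exact: measurable_funX.
rewrite ge0_integralD//; last 4 first.
- by move=> ux _; rewrite lee_fin dyadic_energy_ge0.
- exact: measurableT_comp.
- by move=> ux _; rewrite lee_fin dyadic_energy_ge0.
- exact: measurableT_comp.
rewrite integral_sqr_sum_orbit.
apply: le_trans (leeD (leeD (IH a) (IH (a + 2 ^ j)%N)) (lexx _)) _.
rewrite -!EFinD lee_fin -!mulrDl; apply: ler_wpM2r => //.
rewrite exprS natrX -[j.+2]addn1 -[j.+1]addn1 !natrD.
have : 0 <= 2 ^+ j :> R by rewrite exprn_ge0.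
set t := 2 ^+ j; set n := j%:R => t0.
rewrite -subr_ge0 (_ : _ - _ = t)//; ring.
Qed.

End orbit_sums.

(** * The almost everywhere bound for real functions *)

Section strong_law.
Variables (R : realType) (G : topologicalZmodType) (dist : G -> G -> R).
Hypotheses (hdist : metrized_by dist) (cG : compact [set: G]).
Hypothesis connG : connected [set: G].
Variable mu : probability (borel G) R.
Hypothesis haar_mu : haar_measure mu.
Variable nu : R.
Hypothesis nu_gt : 1 / 2 < nu.

Let rho := 2 `^ nu : R.

Let rho_gt0 : 0 < rho. Proof. exact: powR_gt0. Qed.

(** This makes the ratio [q = 2 / rho ^+ 2] of the series in [ae_orbit_sum_le] smaller than 1. *)
Let rho2_gt2 : 2 < rho ^+ 2.
Proof.
rewrite -powR_mulrn ?ltW// -powRrM /powR pnatr_eq0/=.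
rewrite -[ltLHS](@lnK _ 2) ?posrE// ltr_expR ltr_pMl ?ln_gt0 ?ltr1n//.
by rewrite -ltr_pdivrMr.
Qed.

Lemma ae_orbit_sum_le (f : G -> R) e : 0 < e ->
  measurable_fun setT (f : borel G -> R) ->
  (\int[mu]_x ((f x) ^+ 2)%:E < +oo)%E -> (\int[mu]_x (f x)%:E = 0)%E ->
  {ae (mu \x mu)%E, forall ux, \forall n \near \oo,
    `|\sum_(0 <= k < n) f (ux.2 + ux.1 *+ k)| <= e * n%:R `^ nu}.
Proof.
move=> e0 mf f2 f0.
pose X (ux : borel G * borel G) k := f (ux.2 + ux.1 *+ k).
pose V := fine (\int[mu]_x ((f x) ^+ 2)%:E)%E.
have V0 : 0 <= V by apply/fine_ge0/integral_ge0 => x _; rewrite lee_fin sqr_ge0.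
(* A bound for the maximum of S_n^2 over n <= 2^j, divided by 2^(2 nu j). Its integrals are summable
   in [j], so [W j] tends to 0 almost everywhere. *)
pose W j ux := j.+1%:R * dyadic_energy (X ux) j 0 / (rho ^+ 2) ^+ j.
have W0 j ux : 0 <= W j ux.
  by rewrite /W !mulr_ge0 ?dyadic_energy_ge0// invr_ge0 !exprn_ge0// ltW.
have mE j : measurable_fun setT (fun ux => dyadic_energy (X ux) j 0).
  exact (measurable_dyadic_energy hdist cG mf j 0).
have mW j : measurable_fun setT (W j).
  by apply: measurable_funM => //; apply: measurable_funM.
pose q := 2 / rho ^+ 2.
have q0 : 0 <= q by rewrite divr_ge0// exprn_ge0// ltW.
have q1 : q < 1 by rewrite ltr_pdivrMr ?mul1r// exprn_gt0.
have iW j : (\int[mu \x mu]_ux (W j ux)%:E <= V%:E * (j.+1%:R ^+ 2 * q ^+ j)%:E)%E.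
  pose c := j.+1%:R / (rho ^+ 2) ^+ j.
  have c0 : 0 <= c by rewrite divr_ge0// !exprn_ge0// ltW.
  have -> : (\int[mu \x mu]_ux (W j ux)%:E =
      c%:E * \int[mu \x mu]_ux (dyadic_energy (X ux) j 0)%:E)%E.
    rewrite -ge0_integralZl_EFin//; last 2 first.
    - by move=> ux _; rewrite lee_fin dyadic_energy_ge0.
    - exact: measurableT_comp.
    by apply: eq_integral => ux _; rewrite -EFinM /W /c mulrAC.
  apply: le_trans (lee_wpmul2l _ (integral_dyadic_energy hdist cG connG haar_mu mf f2 f0 j 0)) _.
    by rewrite lee_fin.
  by rewrite -!EFinM lee_fin /c /q expr_div_n -/V le_eqVlt; apply/orP; left; apply/eqP; ring.
have sW : (\int[mu \x mu]_ux \sum_(0 <= j <oo) (W j ux)%:E < +oo)%E.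
  rewrite integral_nneseries//; last 2 first.
  - by move=> j; exact: measurableT_comp.
  - by move=> j ux _; rewrite lee_fin.
  apply: (@le_lt_trans _ _ (\sum_(0 <= j <oo) (V%:E * (j.+1%:R ^+ 2 * q ^+ j)%:E))%E).
    apply: lee_nneseries => j _ // _; apply: integral_ge0 => ux _.
    by rewrite lee_fin.
  rewrite nneseriesZl => [|j _]; last by rewrite lee_fin mulr_ge0// exprn_ge0.
  by apply: lte_mul_pinfty => //; exact: nneseries_sqr_geometric_lty.
have msW : measurable_fun setT (fun ux => (\sum_(0 <= j <oo) (W j ux)%:E)%E).
  apply: ge0_emeasurable_sum => // j; first by move=> ux _ _; rewrite lee_fin.
  by move=> _; exact: measurableT_comp.
have s0 ux : (0 <= \sum_(0 <= j <oo) (W j ux)%:E)%E.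
  by apply: nneseries_ge0 => j _ _; rewrite lee_fin.
have isW : (mu \x mu)%E.-integrable setT (fun ux => \sum_(0 <= j <oo) (W j ux)%:E)%E.
  apply/integrableP; split => //.
  by under eq_integral do rewrite gee0_abs//.
have := integrable_ae measurableT isW.
apply: filterS => ux /(_ I) hux.
have /cvg_series_cvg_0 Wcvg : cvgn (series (W ^~ ux)).
  apply: nnseries_is_cvg => // .
  by rewrite ltey_eq hux.
(* For 2^j <= n < 2^(j+1) the bound comes from [W j.+1]; the division by [rho ^+ 2] pays for the
   passage from 2^(j+1) to 2^j. *)
have d0 : 0 < e ^+ 2 / rho ^+ 2 by rewrite divr_gt0 ?exprn_gt0.
have /cvgrPdist_le/(_ _ d0)[J _ hJ] := Wcvg.
exists (2 ^ J)%N => // n /= nJ.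
have n0 : (0 < n)%N by rewrite (leq_trans _ nJ)// expn_gt0.
pose j := trunc_log 2 n.
have /andP[jn nj] : (2 ^ j <= n < 2 ^ j.+1)%N by exact: trunc_log_bounds.
have Jj : (J <= j.+1)%N.
  by rewrite leqW// -(@trunc_expnK 2 J)//; exact: leq_trunc_log.
have := hJ _ Jj; rewrite sub0r normrN ger0_norm// => hWj.
have nn0 : 0 <= e * n%:R `^ nu by rewrite mulr_ge0 ?powR_ge0// ltW.
rewrite -ler_sqr ?nnegrE// real_normK ?num_real//.
have := sqr_sum_le_dyadic_energy (X ux) 0 (ltnW nj).
rewrite add0n => /le_trans; apply.
have -> : j.+2%:R * dyadic_energy (X ux) j.+1 0 = W j.+1 ux * (rho ^+ 2) ^+ j.+1.
  by rewrite /W divfK// gt_eqF// !exprn_gt0.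
apply: (@le_trans _ _ (e ^+ 2 / rho ^+ 2 * (rho ^+ 2) ^+ j.+1)).
  by rewrite ler_wpM2r// !exprn_ge0// ltW.
rewrite [_ ^+ j.+1]exprS mulrA divfK ?gt_eqF ?exprn_gt0// [leRHS]exprMn -exprM mulnC exprM.
apply: ler_wpM2l; first by rewrite exprn_ge0// ltW.
rewrite lerXn2r ?nnegrE ?powR_ge0 ?exprn_ge0 ?(ltW rho_gt0)//.
rewrite -powR_mulrn ?(ltW rho_gt0)// -powRrM mulrC powRrM powR_mulrn// -natrX.
apply: ge0_ler_powR; rewrite ?nnegrE ?ler_nat//.
by move: nu_gt; lra.
Qed.

End strong_law.

Lemma limn_esup_le (R : realType) (u : nat -> \bar R) c :
  (\forall n \near \oo, u n <= c)%E -> (limn_esup u <= c)%E.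
Proof.
move=> uc; apply: ereal_inf_le; exists (ereal_sup (u @` [set n | (u n <= c)%E])).
  by exists [set n | (u n <= c)%E].
by apply: ge_ereal_sup => _ [n /= + <-].
Qed.

(** * Real and imaginary parts, for both scalar fields at once *)

Section scalar_parts.
Context {R : realType}.

Definition re_part (s : scalars) : scalar_field R s -> R :=
  match s with
  | RealScalars => fun z : R => z
  | ComplexScalars => fun z : R[i] => complex.Re z
  end.

Definition im_part (s : scalars) : scalar_field R s -> R :=
  match s with
  | RealScalars => fun z : R => 0
  | ComplexScalars => fun z : R[i] => complex.Im z
  end.

Variable s : scalars.
Implicit Types z w : scalar_field R s.

Lemma re_partD z w : re_part (z + w) = re_part z + re_part w.
Proof. by case: s z w => [|] //= [a b] [c d]. Qed.

Lemma im_partD z w : im_part (z + w) = im_part z + im_part w.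
Proof. by case: s z w => [|] //= => [_ _|[a b] [c d]//]; rewrite addr0. Qed.

Lemma re_part0 : re_part (0 : scalar_field R s) = 0.
Proof. by case: s. Qed.

Lemma im_part0 : im_part (0 : scalar_field R s) = 0.
Proof. by case: s. Qed.

Let norm_le_sqrt (a b : R) : `|a| <= Num.sqrt (a ^+ 2 + b ^+ 2).
Proof. by rewrite -sqrtr_sqr; apply: ler_wsqrtr; rewrite lerDl sqr_ge0. Qed.

Let sqrt_le_norm (a b : R) : Num.sqrt (a ^+ 2 + b ^+ 2) <= `|a| + `|b|.
Proof.
have h : 0 <= `|a| + `|b| by rewrite addr_ge0.
rewrite -(ger0_norm h) -sqrtr_sqr; apply: ler_wsqrtr; rewrite sqrrD.
by rewrite !real_normK ?num_real// addrAC lerDl mulrn_wge0// mulr_ge0.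
Qed.

Lemma re_part_le z : `|re_part z| <= modulus z.
Proof. by case: s z => [//|[a b]]; exact: norm_le_sqrt. Qed.

Lemma im_part_le z : `|im_part z| <= modulus z.
Proof.
case: s z => [z|[a b]]; first by rewrite /= normr0.
by have := norm_le_sqrt b a; rewrite addrC.
Qed.

Lemma modulus_le_parts z : modulus z <= `|re_part z| + `|im_part z|.
Proof.
case: s z => [z|[a b]]; last exact: sqrt_le_norm.
by rewrite /= normr0 addr0.
Qed.

Lemma part_continuous (h : scalar_field R s -> R) :
  (forall z w, h (z - w) = h z - h w) -> (forall z, `|h z| <= modulus z) ->
  continuous h.
Proof.
move=> hB hle z; apply/(@cvgrPdist_lt _ _ _ (nbhs z)) => e e0.
have /cvgrPdist_lt/(_ _ e0) : modulus (w - z) @[w --> z] --> (0 : R).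
  have m0 : modulus (0 : scalar_field R s) = 0 by exact/modulus_eq0.
  have hz : (w - z) @[w --> z] --> (0 : scalar_field R s).
    by rewrite -(subrr z); exact: (@addr_continuous (scalar_field R s) (- z) z).
  by rewrite -m0; apply: (cvg_comp _ _ hz); exact: modulus_continuous.
apply: filterS => w; rewrite sub0r normrN distrC -hB.
by apply: le_lt_trans; apply: le_trans (hle _) _; exact: ler_norm.
Qed.

Lemma re_part_continuous : continuous (@re_part s).
Proof.
apply: part_continuous => [z w|z]; last exact: re_part_le.
by case: s z w => //= -[a b] [c d].
Qed.

Lemma im_part_continuous : continuous (@im_part s).
Proof.
apply: part_continuous => [z w|z]; last exact: im_part_le.
by case: s z w => [? ?|[a b] [c d]] //=; rewrite subrr.
Qed.

End scalar_parts.

Section modulus_powR.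
Context {R : realType} {s : scalars}.

(** Written with a real power, so that measurability of the modulus reduces to that of the two
    parts. *)
Lemma modulusE (z : scalar_field R s) :
  modulus z = (re_part z ^+ 2 + im_part z ^+ 2) `^ 2^-1.
Proof.
rewrite powR12_sqrt ?addr_ge0 ?sqr_ge0//.
by case: s z => [z|[a b]//]; rewrite /= expr0n addr0 sqrtr_sqr.
Qed.

Lemma re_part_sum (I : Type) (r : seq I) (F : I -> scalar_field R s) :
  re_part (\sum_(i <- r) F i) = \sum_(i <- r) re_part (F i).
Proof. exact: (big_morph _ (@re_partD R s) (@re_part0 R s)). Qed.

Lemma im_part_sum (I : Type) (r : seq I) (F : I -> scalar_field R s) :
  im_part (\sum_(i <- r) F i) = \sum_(i <- r) im_part (F i).
Proof. exact: (big_morph _ (@im_partD R s) (@im_part0 R s)). Qed.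

End modulus_powR.

(** * Measurability of the ergodic sums and of their upper limit *)

Section ergodic_sum_measurable.
Variables (R : realType) (s : scalars) (G : topologicalZmodType).
Variable dist : G -> G -> R.
Hypotheses (hdist : metrized_by dist) (cG : compact [set: G]).
Variable f : G -> scalar_field R s.
Hypothesis mf : measurable_fun setT (f : borel G -> borel (scalar_field R s)).

Lemma measurable_re_part :
  measurable_fun setT ((fun x => re_part (f x)) : borel G -> R).
Proof. exact: (measurable_continuous_comp mf (@re_part_continuous R s)). Qed.

Lemma measurable_im_part :
  measurable_fun setT ((fun x => im_part (f x)) : borel G -> R).
Proof. exact: (measurable_continuous_comp mf (@im_part_continuous R s)). Qed.

Lemma measurable_modulus_ergodic_sum n : measurable_fun setT
  (fun ux : borel G * borel G => modulus (ergodic_sum n ux.1 f ux.2)).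
Proof.
under eq_fun do rewrite modulusE re_part_sum im_part_sum.
apply: (measurableT_comp (measurable_powR _)).
apply: measurable_funD; apply: measurable_funX; apply: measurable_sum => i.
  exact: (measurableT_comp measurable_re_part (measurable_orbit hdist cG i)).
exact: (measurableT_comp measurable_im_part (measurable_orbit hdist cG i)).
Qed.

Lemma measurable_limsup_ergodic nu : measurable_fun setT
  (fun ux : borel G * borel G => limsup_ergodic nu f ux.1 ux.2).
Proof.
apply: measurable_fun_limn_esup => n; apply: measurableT_comp => //.
by apply: measurable_funM => //; exact: measurable_modulus_ergodic_sum.
Qed.

End ergodic_sum_measurable.

(** * The first assertion *)

Section null_limsup.
Variables (R : realType) (s : scalars) (G : topologicalZmodType).
Variable dist : G -> G -> R.
Hypotheses (hdist : metrized_by dist) (cG : compact [set: G]).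
Hypothesis connG : connected [set: G].
Variable mu : probability (borel G) R.
Hypothesis haar_mu : haar_measure mu.

Lemma L2_0_part (f : G -> scalar_field R s) (h : scalar_field R s -> R) :
  continuous h -> (forall z, `|h z| <= modulus z) -> L2_0 mu f ->
  (\int[mu]_x ((h (f x)) ^+ 2)%:E < +oo)%E.
Proof.
move=> ch hle [mf f2 _].
have f2' : (\int[mu]_x ((modulus (f x)) ^+ 2)%:E < +oo)%E.
  move: f2; rewrite /finite_norm => /(poweR_lty 2).
  rewrite poweR_Lnorm//; congr (_ < _)%E; apply: eq_integral => x _ /=.
  by rewrite ger0_norm ?modulus_ge0// powR_mulrn ?modulus_ge0.
apply: le_lt_trans f2'; apply: ge0_le_integral => //.
- by move=> x _; rewrite lee_fin sqr_ge0.
- apply: measurableT_comp => //; apply: measurable_funX.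
  exact: (measurable_continuous_comp mf ch).
- apply: measurableT_comp => //; apply: measurable_funX.
  exact: (measurable_continuous_comp mf (@modulus_continuous R s)).
move=> x _; rewrite lee_fin -real_normK ?num_real//.
by rewrite lerXn2r ?nnegrE// modulus_ge0.
Qed.

Lemma integral_parts0 (f : G -> scalar_field R s) :
  mu.-integrable setT (fun x => (re_part (f x))%:E) ->
  mu.-integrable setT (fun x => (im_part (f x))%:E) ->
  scalar_integral mu f = 0 ->
  (\int[mu]_x (re_part (f x))%:E = 0)%E /\ (\int[mu]_x (im_part (f x))%:E = 0)%E.
Proof.
move=> ire iim I0.
suff : fine (\int[mu]_x (re_part (f x))%:E)%E = 0 /\
       fine (\int[mu]_x (im_part (f x))%:E)%E = 0.
  move=> [h1 h2]; split.
    by rewrite -(@fineK _ (\int[mu]_x _)%E) ?h1// integrable_fin_num.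
  by rewrite -(@fineK _ (\int[mu]_x _)%E) ?h2// integrable_fin_num.
case: s f ire iim I0 => f _ _ /=; first by move=> h; split; [exact: h|rewrite integral0].
by move=> /eqP; rewrite eq_complex => /andP[/eqP /= ? /eqP /= ?].
Qed.

Lemma null_limsup_ergodic (nu : R) (f : G -> scalar_field R s) :
  1 / 2 < nu -> L2_0 mu f ->
  (mu \x mu)%E [set ux : borel G * borel G |
    (1 <= limsup_ergodic nu f ux.1 ux.2)%E] = 0%E.
Proof.
move=> nu12 fL; have [mf _ f0] := fL.
have re2 := L2_0_part (@re_part_continuous R s) (@re_part_le R s) fL.
have im2 := L2_0_part (@im_part_continuous R s) (@im_part_le R s) fL.
have mre := measurable_re_part mf; have mim := measurable_im_part mf.
have [re0 im0] := integral_parts0 (integrable_of_sqr mre re2)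
  (integrable_of_sqr mim im2) f0.
set A := [set _ | _].
have mA : measurable A.
  have := measurable_limsup_ergodic hdist cG mf nu.
  move=> /(_ measurableT `[1%E, +oo[%classic (emeasurable_itv _)).
  rewrite setTI; congr measurable; apply/seteqP; split => ux /=.
    by rewrite in_itv /= andbT.
  by rewrite /A /= in_itv /= andbT.
(* A quarter for each of the two parts bounds the upper limit by [1 / 2], which is strictly less
   than 1. *)
have e0 : 0 < 1 / 4 :> R by rewrite divr_gt0.
apply/(negligibleP _ mA).
have aere := ae_orbit_sum_le hdist cG connG haar_mu nu12 e0 mre re2 re0.
have aeim := ae_orbit_sum_le hdist cG connG haar_mu nu12 e0 mim im2 im0.
have : {ae (mu \x mu)%E, forall ux, ~ A ux}.
  have FF := ae_filter_ringOfSetsType (mu \x mu)%E.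
  have := @filterI _ _ FF _ _ aere aeim.
  apply: (@filterS _ _ FF) => ux [hre him]; rewrite /A /=.
  apply/negP; rewrite -ltNge.
  apply: (@le_lt_trans _ _ (1 / 2)%:E); last by rewrite lte_fin ltr_pdivrMr// mul1r ltr1n.
  apply: limn_esup_le; near=> n.
  have n0 : (0 < n)%N by near: n; exists 1%N.
  rewrite lee_fin ler_pdivrMr ?powR_gt0 ?ltr0n//.
  have h1 : `|\sum_(0 <= k < n) re_part (f (ux.2 + ux.1 *+ k))| <= 1 / 4 * n%:R `^ nu.
    by near: n.
  have h2 : `|\sum_(0 <= k < n) im_part (f (ux.2 + ux.1 *+ k))| <= 1 / 4 * n%:R `^ nu.
    by near: n.
  apply: le_trans (modulus_le_parts _) _; rewrite re_part_sum im_part_sum.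
  move: h1 h2; rewrite !big_mkord; lra.
apply: negligibleS => ux Aux /=; exact.
Unshelve. all: by end_near.
Qed.

End null_limsup.

(** * The simple random walk leaves every parabola *)

Section coin_tossing.
Variable R : rcfType.
Implicit Types (F H : seq bool -> R) (t : seq bool).

(** The expectation over [n] fair tosses; conditioning on the first toss holds by definition. *)
Fixpoint coin_mean (n : nat) (F : seq bool -> R) : R :=
  match n with
  | 0%N => F [::]
  | n.+1 => (coin_mean n (fun t => F (true :: t)) +
             coin_mean n (fun t => F (false :: t))) / 2
  end.

Lemma ler_coin_mean n F H : (forall t, size t = n -> F t <= H t) ->
  coin_mean n F <= coin_mean n H.
Proof.
elim: n F H => [|n IH] F H FH /=; first exact: FH.
by rewrite ler_pM2r// lerD// IH// => t tn; apply: FH => /=; rewrite tn.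
Qed.

Lemma eq_coin_mean n F H : (forall t, size t = n -> F t = H t) ->
  coin_mean n F = coin_mean n H.
Proof.
by move=> FH; apply/eqP; rewrite eq_le !ler_coin_mean// => t /FH ->.
Qed.

Lemma coin_meanD n F H :
  coin_mean n (fun t => F t + H t) = coin_mean n F + coin_mean n H.
Proof. by elim: n F H => [//|n IH] F H /=; rewrite !IH; ring. Qed.

Lemma coin_meanZ n c F : coin_mean n (fun t => c * F t) = c * coin_mean n F.
Proof. by elim: n F => [//|n IH] F /=; rewrite !IH; ring. Qed.

Lemma coin_mean_cst n c : coin_mean n (fun=> c) = c.
Proof. by elim: n => [//|n IH] /=; rewrite IH; field. Qed.

Lemma coin_mean_cat m n F :
  coin_mean (m + n) F = coin_mean m (fun s => coin_mean n (fun t => F (s ++ t))).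
Proof. by elim: m F => [//|m IH] F; rewrite addSn /= !IH. Qed.

Lemma coin_mean_negb n F :
  coin_mean n (fun t => F (map negb t)) = coin_mean n F.
Proof.
elim: n F => [//|n IH] F /=.
by rewrite (IH (fun t => F (false :: t))) (IH (fun t => F (true :: t))) addrC.
Qed.

Definition walk t : R := \sum_(b <- t) (if b then 1 else -1).

Lemma walk_cons b t : walk (b :: t) = (if b then 1 else -1) + walk t.
Proof. by rewrite /walk big_cons. Qed.

Lemma walk_cat s t : walk (s ++ t) = walk s + walk t.
Proof. by rewrite /walk big_cat. Qed.

Lemma walk_negb t : walk (map negb t) = - walk t.
Proof.
by rewrite /walk big_map -sumrN; apply: eq_bigr => -[] _ /=; rewrite ?opprK.
Qed.

Lemma coin_mean_walk2 n : coin_mean n (fun t => walk t ^+ 2) = n%:R.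
Proof.
elim: n => [|n IH] /=; first by rewrite /walk big_nil expr0n.
rewrite -coin_meanD (_ : (coin_mean _ _) = coin_mean n (fun t => 2 * (1 + walk t ^+ 2))).
  by rewrite coin_meanZ coin_meanD coin_mean_cst IH -[n.+1%:R]natr1; field.
by apply: eq_coin_mean => t _; rewrite !walk_cons; ring.
Qed.

Lemma coin_mean_walk4 n : coin_mean n (fun t => walk t ^+ 4) <= 3 * n%:R ^+ 2.
Proof.
elim: n => [|n IH] /=; first by rewrite /walk big_nil expr0n mulr_ge0// exprn_ge0.
rewrite -coin_meanD (_ : (coin_mean _ _) =
    coin_mean n (fun t => 2 * (1 + (6 * walk t ^+ 2 + walk t ^+ 4)))).
  rewrite coin_meanZ coin_meanD coin_mean_cst coin_meanD coin_meanZ.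
  rewrite coin_mean_walk2 -[n.+1%:R]natr1.
  have : 0 <= n%:R :> R by exact: ler0n.
  move: IH; set x := n%:R; set y := coin_mean _ _ => h x0.
  have -> : (x + 1) ^+ 2 = x ^+ 2 + 2 * x + 1 by ring.
  move: h; set z := x ^+ 2 => h.
  lra.
by apply: eq_coin_mean => t _; rewrite !walk_cons; ring.
Qed.

Definition high n t : bool := Num.sqrt n%:R / 2 <= walk t.

(* Second and fourth moments: with [A] the event [n <= 4 walk^2], pointwise
   [walk^2 <= n/4 + walk^4/(6n) + (3n/2) A]. *)
Lemma coin_mean_high n : (0 < n)%N ->
  12^-1 <= coin_mean n (fun t => (high n t)%:R).
Proof.
move=> n0; have nR : 0 < n%:R :> R by rewrite ltr0n.
pose A t : bool := n%:R <= 4 * walk t ^+ 2.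
have h1 : n%:R <= coin_mean n (fun t => n%:R / 4 +
    ((6 * n%:R)^-1 * walk t ^+ 4 + (3 * n%:R / 2) * (A t)%:R)).
  rewrite -{1}(coin_mean_walk2 n); apply: ler_coin_mean => t _.
  have -> : walk t ^+ 4 = (walk t ^+ 2) ^+ 2 by rewrite -exprM.
  rewrite /A; set x := walk t ^+ 2; set N := n%:R in nR *.
  have x0 : 0 <= x by exact: sqr_ge0.
  have [Nx|xN] := leP N (4 * x); last first.
    have : 0 <= (6 * N)^-1 * x ^+ 2.
      by rewrite mulr_ge0 ?sqr_ge0// invr_ge0 mulr_ge0// ltW.
    set u := _ * x ^+ 2; rewrite mulr0; lra.
  (* Expanding this square gives the pointwise inequality on the event [A]. *)
  have : 0 <= (6 * N)^-1 * (x - 3 * N) ^+ 2.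
    by rewrite mulr_ge0 ?sqr_ge0// invr_ge0 mulr_ge0// ltW.
  have -> : (6 * N)^-1 * (x - 3 * N) ^+ 2 = (6 * N)^-1 * x ^+ 2 - x + 3 * N / 2.
    by field; rewrite gt_eqF.
  set u := _ * x ^+ 2; rewrite mulr1; lra.
(* On [A] either the path or its reflection is high, and both have the same law. *)
have h2 : coin_mean n (fun t => (A t)%:R) <= 2 * coin_mean n (fun t => (high n t)%:R).
  rewrite mulr_natl mulr2n -{2}(coin_mean_negb n (fun t => (high n t)%:R)) -coin_meanD.
  apply: ler_coin_mean => t _; rewrite /A /high walk_negb.
  have [h|_] := leP n%:R (4 * walk t ^+ 2); last by rewrite addr_ge0.
  have : Num.sqrt n%:R / 2 <= `|walk t|.
    have : Num.sqrt n%:R <= `|walk t * 2|.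
      rewrite -sqrtr_sqr; apply: ler_wsqrtr; rewrite exprMn.
      by move: h; set z := walk t ^+ 2; lra.
    by rewrite normrM (ger0_norm (ler0n _ 2)) ler_pdivrMr.
  rewrite ler_normr => /orP[->|->]; first by rewrite lerDl.
  by rewrite lerDr.
move: h1; rewrite coin_meanD coin_meanD coin_mean_cst !coin_meanZ => h1.
have h3 : (6 * n%:R)^-1 * coin_mean n (fun t => walk t ^+ 4) <= n%:R / 2.
  apply: le_trans (_ : (6 * n%:R)^-1 * (3 * n%:R ^+ 2) <= _).
    by rewrite ler_wpM2l ?coin_mean_walk4// invr_ge0 mulr_ge0// ltW.
  by rewrite le_eqVlt; apply/orP; left; apply/eqP; field; rewrite gt_eqF.
move: h1 h2 h3; set a := coin_mean n (fun t => (A t)%:R).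
set b := coin_mean n (fun t => (high n t)%:R); set c := _^-1 * _.
move=> h1 h2 h3.
have h4 : n%:R * (1 / 4) <= n%:R * (3 / 2 * a) by lra.
have : 1 / 4 <= 3 / 2 * a by rewrite ler_pM2l in h4.
lra.
Qed.

(** The [L] consecutive blocks of [n] tosses are independent, and each is high with probability at
    least [12^-1]. *)
Lemma coin_mean_far n L : (0 < n)%N ->
  12^-1 ^+ L <= coin_mean (L * n) (fun t => (L%:R * (Num.sqrt n%:R / 2) <= walk t)%R%:R).
Proof.
move=> n0; elim: L => [|L IH].
  by rewrite mul0n /= mul0r expr0 /walk big_nil lexx.
rewrite mulSn coin_mean_cat.
pose B t : R := (L%:R * (Num.sqrt n%:R / 2) <= walk t)%R%:R.
apply: (@le_trans _ _ (coin_mean n (fun s => coin_mean (L * n) B * (high n s)%:R))).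
  rewrite coin_meanZ exprS mulrC; apply: ler_pM; rewrite ?exprn_ge0 ?invr_ge0//.
  exact: coin_mean_high.
apply: ler_coin_mean => s _; rewrite mulrC -coin_meanZ.
apply: ler_coin_mean => t _; rewrite /B walk_cat.
have [hs|_] := boolP (high n s); last by rewrite mul0r.
rewrite mul1r; have [ht|_] := leP _ (walk t); last by [].
by rewrite ler1n lt0b -[L.+1%:R]natr1 mulrDl mul1r addrC lerD.
Qed.

Definition tame (M : nat) t : bool :=
  all (fun k => `|walk (take k t)| <= M%:R * Num.sqrt k%:R) (iota 0 (size t).+1).

Lemma tameP M t : reflect (forall k, (k <= size t)%N ->
  `|walk (take k t)| <= M%:R * Num.sqrt k%:R) (tame M t).
Proof.
apply: (iffP allP) => h k; first by move=> kt; apply: h; rewrite mem_iota.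
by rewrite mem_iota add0n ltnS => /andP[_]; exact: h.
Qed.

(* A path of length [n] that stays tame cannot climb by [L] half-steps [sqrt n / 2]
   during the next [L * n] tosses. *)
Lemma tame_step M n L : (0 < n)%N -> L = (16 * M ^ 2 + 2)%N ->
  coin_mean (n + L * n) (fun t => (tame M t)%:R) <=
  (1 - 12^-1 ^+ L) * coin_mean n (fun t => (tame M t)%:R).
Proof.
move=> n0 LE; rewrite coin_mean_cat.
pose B t := L%:R * (Num.sqrt n%:R / 2) <= walk t.
apply: (@le_trans _ _ (coin_mean n (fun s =>
    (1 - 12^-1 ^+ L) * (tame M s)%:R))); last by rewrite coin_meanZ.
apply: ler_coin_mean => s sn.
apply: (@le_trans _ _ (coin_mean (L * n) (fun t =>
    (tame M s)%:R * (1 + -1 * (B t)%:R)))); last first.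
  rewrite coin_meanZ mulrC ler_wpM2r// coin_meanD coin_mean_cst coin_meanZ.
  by rewrite mulN1r lerD2l lerN2; exact: coin_mean_far.
apply: ler_coin_mean => t tn; rewrite mulN1r.
have [/tameP hst|_] := boolP (tame M (s ++ t)); last first.
  by rewrite mulr_ge0// subr_ge0 lern1 leq_b1.
have hs : tame M s.
  apply/tameP => k ks; have := hst k; rewrite size_cat => /(_ (leq_trans ks (leq_addr _ _))).
  by rewrite takel_cat.
rewrite hs mul1r; have -> : B t = false; last by rewrite subr0.
apply/negbTE; rewrite -ltNge.
have M0 : 0 <= M%:R :> R by exact: ler0n.
set r := Num.sqrt n%:R; have r0 : 0 < r by rewrite sqrtr_gt0 ltr0n.
pose q := Num.sqrt L.+1%:R : R.
have rq : Num.sqrt (size (s ++ t))%:R = q * r.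
  by rewrite size_cat sn tn -mulSn natrM sqrtrM.
have h1 := hst _ (leqnn _); rewrite take_size rq walk_cat in h1.
have h2 : `|walk s| <= M%:R * r.
  by move/tameP: hs => /(_ _ (leqnn _)); rewrite take_size sn.
have q1 : 1 <= q by rewrite -{1}sqrtr1; apply: ler_wsqrtr; rewrite ler1n.
have h3 : walk t <= 2 * (M%:R * (q * r)).
  have h4 : M%:R * r <= M%:R * (q * r) by rewrite ler_wpM2l// ler_peMl// ltW.
  have : walk t <= `|walk s + walk t| + `|walk s|.
    apply: le_trans (ler_norm _) _; rewrite -{1}(addKr (walk s) (walk t)) addrC.
    exact: ler_normB.
  lra.
apply: le_lt_trans h3 _.
(* The purpose of the value of [L]: it gives 16 M^2 (L + 1) < L^2. A tame path moves by at most
   [2 * (M%:R * (q * r))] after time [n], hence by less than [L] half-steps. *)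
have h5 : 4 * M%:R * q < L%:R.
  rewrite -ltr_sqr ?nnegrE ?mulr_ge0 ?sqrtr_ge0// exprMn sqr_sqrtr//.
  rewrite exprMn -!natrX -!natrM ltr_nat LE.
  by set m := (M ^ 2)%N; rewrite !expnS expn0; lia.
have h6 : 4 * M%:R * q * r < L%:R * r by rewrite ltr_pM2r.
have -> : 2 * (M%:R * (q * r)) = (4 * M%:R * q * r) / 2 by field.
by rewrite mulrA ltr_pM2r.
Qed.

End coin_tossing.

(** Iterate [tame_step]: the time is multiplied by [L.+1] and the probability by at most [c < 1],
    where [L] and [c] depend on [M] only. *)
Lemma tame_rare (R : realType) (M : nat) (d : R) : 0 < d ->
  exists2 N, (0 < N)%N & coin_mean N (fun t => (tame R M t)%:R) <= d.
Proof.
move=> d0; pose L := (16 * M ^ 2 + 2)%N; pose c : R := 1 - 12^-1 ^+ L.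
have c0 : 0 <= c by rewrite subr_ge0 exprn_ile1// invf_le1// ler1n.
have c1 : c < 1 by rewrite ltrBlDr ltrDl exprn_gt0// invr_gt0.
have step j : coin_mean (L.+1 ^ j) (fun t => (tame R M t)%:R) <= c ^+ j.
  elim: j => [|j IH].
    rewrite expr0 -[leRHS](coin_mean_cst 1 1); apply: ler_coin_mean => t _.
    by rewrite lern1 leq_b1.
  have n0 : (0 < L.+1 ^ j)%N by rewrite expn_gt0.
  rewrite expnS mulSn exprS; apply: le_trans (tame_step R n0 erefl) _.
  exact: ler_wpM2l.
have : c ^+ n @[n --> \oo] --> 0 by apply: cvg_expr; rewrite ger0_norm.
move=> /cvgrPdist_le/(_ _ d0)[j _ /(_ j (leqnn j))].
rewrite sub0r normrN ger0_norm ?exprn_ge0// => hj.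
exists (L.+1 ^ j)%N; first by rewrite expn_gt0.
exact: le_trans (step j) hj.
Qed.

(** Signs at distinct indices are independent fair tosses. Flipping the sign at [k] is a bijection
    that does not affect the indices of the tail, so both values at [k] carry equal weight. *)
Lemma sum_sign_seq (R : rcfType) (I : finType) (F : seq bool -> R) (i : seq I) :
  uniq i ->
  \sum_(eps : {ffun I -> bool}) F [seq eps k | k <- i] =
  #|{: {ffun I -> bool}}|%:R * coin_mean (size i) F.
Proof.
elim: i F => [|k i IH] F /=; first by rewrite sumr_const mulr_natl.
move=> /andP[ki ui].
pose flip (eps : {ffun I -> bool}) : {ffun I -> bool} :=
  [ffun l => if l == k then ~~ eps l else eps l].
have flipK : involutive flip.
  by move=> eps; apply/ffunP => l; rewrite !ffunE; case: eqP => // _; rewrite negbK.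
set S := \sum_(_ : _) _.
have SE : S = \sum_(eps : {ffun I -> bool}) F (~~ eps k :: [seq eps l | l <- i]).
  rewrite /S (reindex_inj (inv_inj flipK)) /=; apply: eq_bigr => eps _.
  rewrite ffunE eqxx; congr (F (_ :: _)); apply/eq_in_map => l li.
  by rewrite ffunE; case: eqP => // lk; move: ki; rewrite -lk li.
have : S + S = \sum_(eps : {ffun I -> bool}) F (true :: [seq eps l | l <- i]) +
               \sum_(eps : {ffun I -> bool}) F (false :: [seq eps l | l <- i]).
  rewrite {2}SE -!big_split; apply: eq_bigr => eps _ /=.
  by case: (eps k) => //=; rewrite addrC.
rewrite (IH (fun t => F (true :: t)) ui) (IH (fun t => F (false :: t)) ui).
lra.
Qed.

(** * Escaping functions *)

Section small_balls.
Variables (R : realType) (G : topologicalZmodType) (dist : G -> G -> R).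
Hypotheses (hdist : metrized_by dist) (connG : connected [set: G]).
Hypothesis G_nontrivial : exists x : G, x != 0.
Variable mu : probability (borel G) R.
Hypothesis haar_mu : haar_measure mu.

Lemma measurable_dist x : measurable_fun setT (dist x : borel G -> R).
Proof. exact: continuous_measurable_real (@dist_continuous _ _ _ hdist x). Qed.

Lemma measurable_point (x : G) : measurable ([set x] : set (borel G)).
Proof.
have -> : [set x] = dist x @^-1` [set 0].
  apply/seteqP; split => y /=; first by move=> ->; rewrite distxx.
  by move/(dist_eq0 hdist).
by rewrite -[_ @^-1` _]setTI; exact: measurable_dist.
Qed.

(** If no point were at distance [r] from 0, the open ball of radius [r] would be closed as well; it
    contains 0 but not [x]. *)
Lemma dist_surj (x : G) (r : R) : 0 < r -> r < dist 0 x -> exists y, dist 0 y = r.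
Proof.
move=> r0 rx; apply: contrapT => hy.
have /continuousP c0 := @dist_continuous _ _ _ hdist 0.
suff : [set y | dist 0 y < r] = setT.
  by move=> /seteqP[_ /(_ x I)]/=; rewrite ltNge ltW.
apply: connG.
- by exists 0; rewrite /= distxx.
- exists [set y | dist 0 y < r]; last by rewrite setTI.
  have -> : [set y | dist 0 y < r] = dist 0 @^-1` `]-oo, r[%classic.
    by apply/seteqP; split => y /=; rewrite in_itv.
  exact/c0/lray_open.
exists [set y | dist 0 y < r]; last by rewrite setTI.
rewrite -openC.
have -> : ~` [set y | dist 0 y < r] = dist 0 @^-1` `]r, +oo[%classic.
  apply/seteqP; split => y /=; rewrite in_itv/= andbT; last first.
    by move=> /ltW yr; rewrite ltNge yr.
  by move=> /negP; rewrite -leNgt le_eqVlt => /orP[/eqP ry|//]; case: hy; exists y.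
exact/c0/rray_open.
Qed.

(** All points have the same mass, and [dist_surj] produces infinitely many points; the total mass
    is finite. *)
Lemma haar_point (x : G) : mu [set x] = 0%E.
Proof.
have pt y : mu [set y] = mu [set (0 : G)].
  rewrite -(haar_mu y (measurable_point 0)) image_set1 addr0 //.
rewrite pt; apply/eqP; rewrite eq_le measure_ge0 andbT leNgt; apply/negP => c0.
have [x0 x00] := G_nontrivial.
have D0 : 0 < dist 0 x0.
  rewrite lt_neqAle (dist_ge0 hdist) andbT eq_sym.
  by apply: contra x00 => /eqP/(dist_eq0 hdist) ->.
have /choice[y hy] n : exists y, dist 0 y = dist 0 x0 / n.+2%:R.
  apply: (@dist_surj x0); first by rewrite divr_gt0.
  by rewrite ltr_pdivrMr// ltr_pMr// ltr1n.
have yinj : injective y.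
  move=> m n ymn; have := hy m; rewrite ymn hy => /(mulfI (lt0r_neq0 D0))/invr_inj/eqP.
  by rewrite eqr_nat => /eqP[].
have mF n : measurable ([set y n] : set (borel G)) by exact: measurable_point.
have c_fin : mu [set (0 : G)] \is a fin_num by exact: fin_num_measure (measurable_point 0).
pose c := fine (mu [set (0 : G)]).
have cE : mu [set (0 : G)] = c%:E by rewrite fineK.
have {}c0 : 0 < c by rewrite -lte_fin -cE.
have hsum n : n%:R * c <= 1.
  rewrite -lee_fin -[leRHS](probability_setT mu).
  apply: (@le_trans _ _ (mu (\bigcup_n [set y n]))); last first.
    by apply: le_measure; rewrite ?inE//; exact: bigcup_measurable.
  rewrite measure_bigcup//; last first.
    by apply/trivIsetP => i j _ _ ij; apply/seteqP; split => // z [/= -> /yinj/eqP]; rewrite (negPf ij).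
  rewrite (@eq_eseriesr _ _ (fun=> c%:E)) => [|i _]; last exact: (etrans (pt _) cE).
  apply: le_trans (_ : \sum_(0 <= i < n | i \in setT) c%:E <= _)%E; last first.
    by apply: nneseries_lim_ge => i _ _; rewrite lee_fin ltW.
  under eq_bigl do rewrite in_setT.
  by rewrite sumEFin lee_fin big_mkord sumr_const card_ord mulr_natl.
have := archi_boundP (ltW (divr_gt0 ltr01 c0)); rewrite ltr_pdivrMr// ltNge.
by rewrite hsum.
Qed.

Lemma measurable_ball x (r : R) : measurable ([set y | dist x y < r] : set (borel G)).
Proof.
have -> : [set y | dist x y < r] = dist x @^-1` `]-oo, r[%classic.
  by apply/seteqP; split => y /=; rewrite in_itv.
by rewrite -[_ @^-1` _]setTI; apply: measurable_dist.
Qed.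

Lemma small_ball x (eta : R) : 0 < eta ->
  exists2 r : R, 0 < r & (mu [set y | (dist x y < r)%R] <= eta%:E)%E.
Proof.
move=> eta0; pose F n := [set y | dist x y < n.+1%:R^-1].
have F0 : \bigcap_n F n = [set x].
  apply/seteqP; split => [y hy|_ -> n _]; last by rewrite /F /= distxx// invr_gt0.
  apply/esym/(dist_eq0 hdist)/eqP; rewrite eq_le (dist_ge0 hdist) andbT leNgt.
  apply/negP => xy0; have [n _ /(_ n (leqnn n)) hn] := near_infty_natSinv_lt (PosNum xy0).
  by have := hy n I; rewrite /F /= ltNge ltW.
have mF n : measurable (F n : set (borel G)) by exact: measurable_ball.
have mcap : measurable (\bigcap_n F n : set (borel G)).
  by rewrite F0; exact: measurable_point.
have mu_cap : mu (\bigcap_n F n) = 0%E by rewrite F0; exact: haar_point.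
have muF : (mu (F 0%N) < +oo)%E.
  by rewrite (le_lt_trans (probability_le1 _ _))// ltry.
have ndF : nonincreasing_seq (F : (set (borel G))^nat).
  move=> m n mn; apply/subsetPset => y; rewrite /F /= => /lt_le_trans; apply.
  by rewrite lef_pV2 ?posrE// ler_nat.
have := @nonincreasing_cvg_mu _ _ _ mu (F : (set (borel G))^nat) muF mF mcap ndF.
rewrite [X in _ --> X]mu_cap => mu_cvg.
have nb : nbhs (0%E : \bar R) [set z | (z < eta%:E)%E].
  by apply: open_nbhs_nbhs; split; [exact: open_ereal_lt_ereal|rewrite /= lte_fin].
have [n _ /(_ n (leqnn n))/= hn] := mu_cvg _ nb.
by exists n.+1%:R^-1; [rewrite invr_gt0|exact: ltW].
Qed.

End small_balls.

(** * Stick breaking *)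

Section stick_breaking.
Variables (R : realType) (w : nat -> R).
Hypotheses (w0 : forall i, 0 <= w i) (w1 : forall i, w i <= 1).

(** Piece [i] takes the fraction [w i] of what the earlier pieces have left: a continuous substitute
    for making a cover disjoint. *)
Definition stick i : R := w i * \prod_(0 <= j < i) (1 - w j).

Lemma stick_ge0 i : 0 <= stick i.
Proof. by rewrite mulr_ge0// prodr_ge0// => j _; rewrite subr_ge0. Qed.

Lemma stick_le i : stick i <= w i.
Proof.
rewrite -[leRHS]mulr1 ler_wpM2l//; apply: prodr_ile1 => j _.
by rewrite subr_ge0 w1 gerBl w0.
Qed.

Lemma sum_stick J : \sum_(0 <= i < J) stick i = 1 - \prod_(0 <= j < J) (1 - w j).
Proof.
elim: J => [|J IH]; first by rewrite !big_geq// subrr.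
by rewrite !big_nat_recr//= IH /stick; ring.
Qed.

Lemma sum_stick_le1 J : \sum_(0 <= i < J) stick i <= 1.
Proof. by rewrite sum_stick gerBl prodr_ge0// => j _; rewrite subr_ge0. Qed.

End stick_breaking.

Lemma exists_natS_mul_ge1 (R : realType) (x : R) : 0 < x ->
  exists n : nat, 1 <= n.+1%:R * x.
Proof.
move=> x0; have := archi_boundP (ltW (divr_gt0 ltr01 x0)).
rewrite ltr_pdivrMr// => h; exists (Num.bound (1 / x)).
by rewrite (le_trans (ltW h))// ler_pM2r// ler_nat.
Qed.

(** * Continuous cells of small measure *)

Section partition_of_unity.
Variables (R : realType) (G : topologicalZmodType) (dist : G -> G -> R).
Hypotheses (hdist : metrized_by dist) (cG : compact [set: G]).
Hypothesis connG : connected [set: G].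
Hypothesis G_nontrivial : exists x : G, x != 0.
Variable mu : probability (borel G) R.
Hypothesis haar_mu : haar_measure mu.

(** Break the stick along a finite cover by balls of measure at most [eta]. The last conclusion says
    that most points lie fully in one cell. *)
Lemma small_partition (eta : R) : 0 < eta ->
  exists (J : nat) (h : nat -> G -> R),
  [/\ forall i, continuous (h i), forall i z, 0 <= h i z,
      forall z, \sum_(0 <= i < J) h i z <= 1,
      forall i, (i < J)%N -> (\int[mu]_z (h i z)%:E <= eta%:E)%E &
      (mu [set z | forall i, (i < J)%N -> (h i z < 1)%R] <= eta%:E)%E].
Proof.
move=> eta0.
have /choice[r hr] x : exists r : R, 0 < r /\
    (mu [set y | (dist x y < r)%R] <= eta%:E)%E.
  have [r r0 hr] := small_ball hdist connG G_nontrivial haar_mu x eta0.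
  by exists r.
pose V x := [set y | dist x y < r x].
have nV x : nbhs x (V x).
  by apply/(nbhs_dist hdist); exists (r x) => //; exact: (hr x).1.
have [X hX] := finite_subcover cG nV.
pose J := size X; pose c i := nth 0 X i.
pose rho i z := Num.max 0 (r (c i) - dist (c i) z).
pose w n z i := Num.min 1 (n.+1%:R * rho i z).
have rho0 i z : 0 <= rho i z by rewrite le_max lexx.
have w0 n z i : 0 <= w n z i by rewrite le_min ler01 mulr_ge0.
have w1 n z i : w n z i <= 1 by rewrite ge_min lexx.
(* As [n] grows, [h n i] tends to the indicator of the [i]-th ball minus the earlier ones. *)
pose h n i z := stick (w n z) i.
have crho i : continuous (rho i).
  apply: max_fun_continuous; first exact: cst_continuous.
  move=> z; apply: cvgB; first exact: cvg_cst.
  exact: (@dist_continuous _ _ _ hdist).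
have cw n i : continuous (fun z => w n z i).
  apply: min_fun_continuous; first exact: cst_continuous.
  move=> z; apply: cvgM; first exact: cvg_cst.
  exact: crho.
have ch n i : continuous (h n i).
  rewrite /h /stick => z; apply: cvgM; first exact: cw.
  apply: (@continuous_big R nat *%R 1 xpredT mul_continuous G (index_iota 0 i)
    (fun j z => 1 - w n z j)) => j _ y.
  apply: cvgB; first exact: cvg_cst.
  exact: cw.
have mrho i : measurable_fun setT (rho i : borel G -> R).
  exact: continuous_measurable_real.
(* On [Y n] some cell function is at least 1. These sets increase to G: at each point the first ball
   that contains it works for large [n]. So the complement is eventually small. *)
pose Y n : set (borel G) := \bigcup_(i in [set i | (i < J)%N])
  ([set z | 1 <= n.+1%:R * rho i z] `&` \bigcap_(j in [set j | (j < i)%N]) [set z | rho j z = 0]).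
have mY n : measurable (Y n).
  apply: bigcup_measurable => i _; apply: measurableI.
    have -> : [set z | 1 <= n.+1%:R * rho i z] = rho i @^-1` `[n.+1%:R^-1, +oo[%classic.
      by apply/seteqP; split => z /=; rewrite in_itv/= andbT -ler_pdivrMl// mulr1.
    by rewrite -[_ @^-1` _]setTI; apply: mrho.
  apply: bigcap_measurableType => j _.
  rewrite (_ : [set z | rho j z = 0] = rho j @^-1` [set 0])//.
  by rewrite -[_ @^-1` _]setTI; apply: mrho.
have Yh n z : Y n z -> exists2 i, (i < J)%N & 1 <= h n i z.
  move=> [i /= iJ [/= hi hj]]; exists i => //.
  rewrite /h /stick {1}/w (min_idPl hi) mul1r big1_seq// => j /=.
  rewrite mem_index_iota => /= ji.
  by rewrite /w (hj j ji) mulr0 min_r ?ler01// subr0.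
have UY : \bigcup_n Y n = setT.
  apply/seteqP; split => // z _.
  have [x xX Vxz] := hX z.
  have ex : exists i, (i < J)%N && (0 < rho i z).
    exists (index x X); rewrite index_mem xX /rho /c nth_index// lt_max.
    by rewrite subr_gt0 Vxz orbT.
  case: (ex_minnP ex) => i /andP[iJ rhoi] imin.
  have [n hn] := exists_natS_mul_ge1 rhoi.
  exists n => //; exists i => //; split => // j /= ji.
  apply/eqP; rewrite eq_le rho0 andbT leNgt; apply/negP => rhoj.
  have := imin j; rewrite rhoj (ltn_trans ji iJ) => /(_ isT).
  by rewrite leqNgt ji.
have ndY : nondecreasing_seq Y.
  move=> m n mn; apply/subsetPset => z [i iJ [h1 h2]]; exists i => //; split => //=.
  by apply: le_trans h1 _; rewrite ler_wpM2r// ler_nat.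
have := @nondecreasing_cvg_mu _ _ _ mu Y mY; rewrite UY => /(_ measurableT ndY).
rewrite [X in _ --> X](@probability_setT _ _ _ mu) => Y_cvg.
have nb : nbhs (1%E : \bar R) [set z | ((1 - eta)%:E < z)%E].
  apply: open_nbhs_nbhs; split; first exact: open_ereal_gt_ereal.
  by rewrite /= lte_fin ltrBlDr ltrDl.
have [n _ /(_ n (leqnn n))/= hn] := Y_cvg _ nb.
exists J, (h n); split.
- exact: ch.
- by move=> i z; exact: stick_ge0.
- by move=> z; exact: sum_stick_le1.
- move=> i iJ; apply: le_trans (hr (c i)).2.
  have mV : measurable (V (c i) : set (borel G)) by exact: measurable_ball.
  apply: (@le_trans _ _ (\int[mu]_z (\1_(V (c i) : set (borel G)) z)%:E)%E); last first.
    by rewrite integral_indic// setIT.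
  apply: ge0_le_integral => //.
  + by move=> z _; rewrite lee_fin stick_ge0.
  + by apply: measurableT_comp => //; exact: continuous_measurable_real.
  + by apply: measurableT_comp => //; exact: measurable_indic.
  move=> z _; rewrite lee_fin; apply: le_trans (stick_le (w0 n z) (w1 n z) i) _.
  rewrite indicE; have [zV|zV] := boolP (z \in V (c i)); first exact: w1.
  have -> : w n z i = 0; last by [].
  move: zV; rewrite notin_setE /V/= => /negP; rewrite -leNgt => h1.
  rewrite /w /rho (max_idPl _) ?mulr0 ?min_r// ?ler01//.
  by rewrite subr_le0.
apply: (@le_trans _ _ (mu (~` Y n))).
  apply: le_measure; rewrite ?inE//; last 2 first.
  - exact: measurableC.
  - by move=> z hz /Yh[i iJ]; rewrite leNgt hz.
  rewrite (_ : [set z | _] = \bigcap_(i in [set i | (i < J)%N]) [set z | h n i z < 1]).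
    apply: bigcap_measurableType => i _.
    rewrite (_ : [set z | h n i z < 1] = h n i @^-1` `]-oo, 1[%classic).
      by rewrite -[_ @^-1` _]setTI; apply: (continuous_measurable_real (ch n i)).
    by apply/seteqP; split => z /=; rewrite in_itv.
  by apply/seteqP; split => z hz i; exact: hz.
have fY : mu (Y n) \is a fin_num by exact: fin_num_measure.
rewrite probability_setC// leeBlDr//.
by rewrite addeC -leeBlDr// -EFinB; exact: ltW.
Qed.

End partition_of_unity.

(** * Sums with random signs *)

Section random_signs.
Variables (R : rcfType) (I : finType).
Implicit Types (eps : {ffun I -> bool}) (c : I -> R).

Definition sign (b : bool) : R := if b then 1 else -1.

Lemma norm_sign b : `|sign b| = 1.
Proof. by case: b; rewrite /sign ?normrN normr1. Qed.

Lemma sum_sign2 (i j : I) :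
  \sum_(eps : {ffun I -> bool}) sign (eps i) * sign (eps j) =
  #|{: {ffun I -> bool}}|%:R * (i == j)%:R.
Proof.
have [<-|ij] := eqVneq i j.
  rewrite mulr1 -sum1_card natr_sum; apply: eq_bigr => eps _.
  by rewrite /sign; case: (eps i); rewrite ?mulrNN mulr1.
have := @sum_sign_seq R I (fun t => sign (nth false t 0) * sign (nth false t 1)) [:: i; j].
rewrite /= inE ij => /(_ isT) ->; rewrite /sign; ring.
Qed.

Lemma sum_signed_sum_sqr c :
  \sum_(eps : {ffun I -> bool}) (\sum_i sign (eps i) * c i) ^+ 2 =
  #|{: {ffun I -> bool}}|%:R * \sum_i c i ^+ 2.
Proof.
under eq_bigr do rewrite expr2 big_distrlr /=.
rewrite exchange_big /= mulr_sumr; apply: eq_bigr => i _.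
rewrite exchange_big /= (bigD1 i)//= [X in _ + X]big1 ?addr0 => [|j ji].
  rewrite (eq_bigr (fun eps : {ffun I -> bool} => (sign (eps i) * sign (eps i)) * c i ^+ 2)).
    by rewrite -mulr_suml sum_sign2 eqxx mulr1.
  by move=> eps _; ring.
rewrite (eq_bigr (fun eps : {ffun I -> bool} => (sign (eps i) * sign (eps j)) * (c i * c j))).
  by rewrite -mulr_suml sum_sign2 eq_sym (negPf ji) mulr0 mul0r.
by move=> eps _; ring.
Qed.

(** A weight equal to 1 leaves nothing for the others, so a point fully in one cell sees the sign of
    that cell only. *)
Lemma signed_sum_pinned c eps i : (forall j, 0 <= c j) -> \sum_j c j <= 1 ->
  1 <= c i -> \sum_j sign (eps j) * c j = sign (eps i).
Proof.
move=> c0; rewrite (bigD1 i)//= => cs ci.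
have s00 : 0 <= \sum_(j | j != i) c j by rewrite sumr_ge0.
have ci1 : c i = 1 by lra.
rewrite (bigD1 i)//= ci1 mulr1 big1 ?addr0// => j ji.
have -> : c j = 0; last by rewrite mulr0.
apply/eqP; rewrite eq_le c0 andbT.
apply: (@le_trans _ _ (\sum_(j | j != i) c j)); last lra.
by rewrite (bigD1 j)//= lerDl sumr_ge0.
Qed.

Lemma norm_signed_sum c eps : (forall j, 0 <= c j) ->
  `|\sum_j sign (eps j) * c j| <= \sum_j c j.
Proof.
move=> c0; apply: le_trans (ler_norm_sum _ _ _) _; apply: ler_sum => j _.
by rewrite normrM norm_sign mul1r ger0_norm.
Qed.

End random_signs.

Lemma exists_le_mean (R : realDomainType) (I : finType) (i0 : I) (X : I -> R) B :
  \sum_i X i <= #|I|%:R * B -> exists i, X i <= B.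
Proof.
move=> XB; apply: contrapT => hX.
have {}hX i : 0 < X i - B.
  by rewrite subr_gt0 ltNge; apply/negP => XiB; apply: hX; exists i.
have : \sum_i (X i - B) <= 0.
  by rewrite sumrB sumr_const -[X in _ - X]mulr_natl subr_le0.
rewrite (bigD1 i0)//= leNgt ltr_wpDr// sumr_ge0// => i _; exact: ltW.
Qed.

Lemma bounded_integrable (R : realType) d (T : measurableType d)
    (P : probability T R) (f : T -> R) B :
  measurable_fun setT f -> (forall x, `|f x| <= B) ->
  P.-integrable setT (EFin \o f).
Proof.
move=> mf fB; apply: (le_integrable measurableT) (_ : P.-integrable setT (cst B%:E)).
- exact: measurableT_comp.
- by move=> x _; rewrite /= lee_fin (le_trans (fB x))// ler_norm.
- exact: finite_measure_integrable_cst.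
Qed.

Lemma product_fin_num (R : realType) d1 d2 (T1 : measurableType d1)
    (T2 : measurableType d2) (P1 : probability T1 R) (P2 : probability T2 R) A :
  measurable A -> (P1 \x P2)%E A \is a fin_num.
Proof.
move=> mA; rewrite ge0_fin_numE ?measure_ge0//.
exact: le_lt_trans (probability_le1 (P1 \x P2)%E mA) (ltry _).
Qed.

(** * Random signs on the cells *)

Section signed_partition.
Variables (R : realType) (G : topologicalZmodType) (dist : G -> G -> R).
Hypotheses (hdist : metrized_by dist) (cG : compact [set: G]).
Hypothesis connG : connected [set: G].
Variable mu : probability (borel G) R.
Hypothesis haar_mu : haar_measure mu.
Variables (J : nat) (h : 'I_J -> G -> R) (eta : R).
Hypotheses (ch : forall i, continuous (h i)) (h0 : forall i z, 0 <= h i z).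
Hypothesis h_sum : forall z, \sum_i h i z <= 1.
Hypothesis h_int : forall i, (\int[mu]_z (h i z)%:E <= eta%:E)%E.
Let Z : set (borel G) := [set z | forall i, h i z < 1].
Hypothesis Z_small : (mu Z <= eta%:E)%E.

Local Notation Om := (borel G * borel G)%type.
Local Notation P := (mu \x mu)%E.

Let mh i : measurable_fun setT (h i : borel G -> R).
Proof. exact: continuous_measurable_real. Qed.

Let h1 i z : h i z <= 1.
Proof.
by apply: le_trans (h_sum z); rewrite (bigD1 i)//= lerDl sumr_ge0.
Qed.

Let mZ : measurable Z.
Proof.
rewrite (_ : Z = \bigcap_(i in [set: 'I_J]) (h i @^-1` `]-oo, 1[%classic)).
  apply: fin_bigcap_measurable => // i _.
  by rewrite -[_ @^-1` _]setTI; exact: mh.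
apply/seteqP; split => [z hz i _|z hz i].
  by rewrite /= in_itv /=; exact: hz.
by have := hz i I; rewrite /= in_itv.
Qed.

Let c i := fine (\int[mu]_z (h i z)%:E)%E.

Let cE i : (\int[mu]_z (h i z)%:E)%E = (c i)%:E.
Proof.
rewrite fineK// ge0_fin_numE; first exact: le_lt_trans (h_int i) (ltry _).
by apply: integral_ge0 => z _; rewrite lee_fin.
Qed.

Let c_ge0 i : 0 <= c i.
Proof. by rewrite fine_ge0// integral_ge0// => z _; rewrite lee_fin. Qed.

Let mhE i : measurable_fun setT (fun z : borel G => (h i z)%:E).
Proof. exact: measurableT_comp. Qed.

Lemma sum_mean_le1 : \sum_i c i <= 1.
Proof.
rewrite -lee_fin -sumEFin; under eq_bigr do rewrite -cE.
rewrite -ge0_integral_sum//; last by move=> i z _; rewrite lee_fin.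
apply: (@le_trans _ _ (\int[mu]_z (cst 1%:E) z)%E).
  apply: ge0_le_integral => //.
  - by move=> z _; rewrite sume_ge0// => i _; rewrite lee_fin.
  - exact: emeasurable_sum.
  by move=> z _; rewrite sumEFin lee_fin.
by rewrite integral_cst// mul1e probability_le1.
Qed.

Lemma eta_ge0 : 0 <= eta.
Proof. by rewrite -lee_fin; apply: le_trans Z_small. Qed.

(** The sum is the weighted probability that two independent points share a cell. *)
Lemma sum_mean_sqr_le : \sum_i c i ^+ 2 <= eta.
Proof.
apply: (@le_trans _ _ (eta * \sum_i c i)); last first.
  by rewrite -[leRHS]mulr1 ler_wpM2l ?eta_ge0 ?sum_mean_le1.
rewrite mulr_sumr; apply: ler_sum => i _; rewrite expr2 ler_wpM2r//.
by rewrite -lee_fin -cE.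
Qed.

Definition signed (eps : {ffun 'I_J -> bool}) (z : G) : R :=
  \sum_i sign R (eps i) * h i z.

Lemma signed_continuous eps : continuous (signed eps).
Proof.
apply: (@continuous_big R 'I_J +%R 0 xpredT add_continuous G _
  (fun i z => sign R (eps i) * h i z)) => i _ z.
by apply: cvgM; [exact: cvg_cst|exact: ch].
Qed.

Lemma norm_signed_le1 eps z : `|signed eps z| <= 1.
Proof. exact: le_trans (norm_signed_sum _ _) (h_sum z). Qed.

Lemma integral_signed eps :
  (\int[mu]_z (signed eps z)%:E = (\sum_i sign R (eps i) * c i)%:E)%E.
Proof.
have ih i : mu.-integrable setT (EFin \o h i).
  by apply: (@bounded_integrable _ _ _ _ _ 1) => // z; rewrite ger0_norm.
under eq_integral do rewrite -sumEFin.
rewrite integral_sum//; last first.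
  move=> i; under eq_fun do rewrite EFinM.
  exact: (integrableZl measurableT _ (ih i)).
rewrite -sumEFin; apply: eq_bigr => i _.
under eq_integral do rewrite EFinM.
rewrite EFinM -cE; exact: (integralZl measurableT (ih i)).
Qed.

(* Dominates the event that two of the first N orbit points, or none of them
   fully, lie in a common cell of the partition. *)
Definition collision (N : nat) (ux : Om) : R :=
  \sum_(k < N) \1_Z (ux.2 + ux.1 *+ k) +
  \sum_(l < N) \sum_(k < l) \sum_i h i (ux.2 + ux.1 *+ k) * h i (ux.2 + ux.1 *+ l).

(** Each orbit point is Haar distributed, so it avoids the full cells with probability at most
    [eta]. Each of the at most N^2 pairs is independent, so it shares a cell with weight at most
    [eta]. *)
Lemma integral_collision N :
  (\int[P]_ux (collision N ux)%:E <= (N%:R * eta + N%:R * (N%:R * eta))%:E)%E.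
Proof.
have mZo k : measurable_fun setT (fun ux : Om => (\1_Z (ux.2 + ux.1 *+ k) : R)%:E).
  apply: measurableT_comp => //.
  exact: (measurableT_comp (measurable_indic mZ) (measurable_orbit hdist cG k)).
have mho i k : measurable_fun setT (fun ux : Om => h i (ux.2 + ux.1 *+ k)).
  exact: (measurableT_comp (mh i) (measurable_orbit hdist cG k)).
have mhh k l i : measurable_fun setT (fun ux : Om =>
    (h i (ux.2 + ux.1 *+ k) * h i (ux.2 + ux.1 *+ l))%:E).
  by apply: measurableT_comp => //; exact: measurable_funM.
rewrite /collision.
under eq_integral do rewrite EFinD -sumEFin -[in X in (_ + X)%E]sumEFin.
have mS k l : measurable_fun setT (fun ux : Om =>
    (\sum_i h i (ux.2 + ux.1 *+ k) * h i (ux.2 + ux.1 *+ l))%:E).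
  by under eq_fun do rewrite -sumEFin; exact: emeasurable_sum.
have S0 k l ux : (0%:E <= (\sum_i h i (ux.2 + ux.1 *+ k) * h i (ux.2 + ux.1 *+ l))%:E :> \bar R)%E.
  by rewrite lee_fin sumr_ge0// => i _; rewrite mulr_ge0.
have mSS (l : 'I_N) : measurable_fun setT (fun ux : Om =>
    (\sum_(k < l) \sum_i h i (ux.2 + ux.1 *+ k) * h i (ux.2 + ux.1 *+ l))%:E).
  by under eq_fun do rewrite -sumEFin; exact: emeasurable_sum.
have SS0 (l : 'I_N) ux : (0%:E <= (\sum_(k < l) \sum_i h i (ux.2 + ux.1 *+ k) * h i (ux.2 + ux.1 *+ l))%:E :> \bar R)%E.
  by rewrite -sumEFin sume_ge0.
rewrite ge0_integralD//; last 4 first.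
- by move=> ux _; rewrite sume_ge0// => k _; rewrite lee_fin.
- exact: emeasurable_sum.
- by move=> ux _; rewrite sume_ge0.
- exact: emeasurable_sum.
rewrite EFinD; apply: leeD.
  rewrite ge0_integral_sum//.
  apply: (@le_trans _ _ (\sum_(k < N) eta%:E)%E).
    apply: lee_sum => k _.
    rewrite (ge0_integral_orbit hdist cG haar_mu k (g := fun z => (\1_Z z)%:E)).
    - by rewrite integral_indic// setIT.
    - by apply: measurableT_comp => //; exact: measurable_indic.
    - by move=> z; rewrite lee_fin.
  by rewrite sumEFin sumr_const card_ord mulr_natl.
rewrite ge0_integral_sum//.
apply: (@le_trans _ _ (\sum_(l < N) (N%:R * eta)%:E)%E); last first.
  by rewrite sumEFin sumr_const card_ord lee_fin -[leLHS]mulr_natl.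
apply: lee_sum => l _.
under eq_integral do rewrite -sumEFin.
rewrite ge0_integral_sum//.
apply: (@le_trans _ _ (\sum_(k < l) eta%:E)%E); last first.
  rewrite sumEFin sumr_const card_ord lee_fin -[leLHS]mulr_natl ler_wpM2r ?eta_ge0//.
  by rewrite ler_nat ltnW.
apply: lee_sum => k _.
under eq_integral do rewrite -sumEFin.
rewrite ge0_integral_sum//; last by move=> i ux _; rewrite lee_fin mulr_ge0.
apply: le_trans (_ : (\sum_i c i ^+ 2)%:E <= _)%E; last first.
  by rewrite lee_fin sum_mean_sqr_le.
rewrite -sumEFin; apply: lee_sum => i _.
pose H (z : Om) := (h i z.1 * h i z.2)%:E.
have mH : measurable_fun setT H.
  apply: measurableT_comp => //; apply: measurable_funM.
    exact: (measurableT_comp (mh i) measurable_fst).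
  exact: (measurableT_comp (mh i) measurable_snd).
have H0 z : (0 <= H z)%E by rewrite lee_fin mulr_ge0.
rewrite (ge0_integral_orbit2 hdist cG haar_mu connG (ltn_ord k) mH H0).
rewrite fubini_tonelli1// /fubini_F /H /=.
under eq_integral do under eq_integral do rewrite EFinM.
under eq_integral => x _.
  rewrite ge0_integralZl_EFin//; last by move=> z _; rewrite lee_fin.
  rewrite cE muleC.
  over.
by rewrite ge0_integralZl_EFin// ?cE// => z _; rewrite lee_fin.
Qed.

Definition confined (M N : nat) (g : G -> R) : set Om :=
  [set ux | forall n, (n <= N)%N ->
    `|\sum_(k < n) g (ux.2 + ux.1 *+ k)| <= M%:R * Num.sqrt n%:R].

Lemma measurable_confined M N g : measurable_fun setT (g : borel G -> R) ->
  measurable (confined M N g).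
Proof.
move=> mg.
rewrite (_ : confined M N g = \bigcap_(n in [set n | (n <= N)%N])
   ((fun ux : Om => `|\sum_(k < n) g (ux.2 + ux.1 *+ k)|) @^-1`
     `]-oo, (M%:R * Num.sqrt n%:R)]%classic)).
  apply: bigcap_measurableType => n _; rewrite -[_ @^-1` _]setTI.
  have ms : measurable_fun setT (fun ux : Om => \sum_(k < n) g (ux.2 + ux.1 *+ k)).
    by apply: measurable_sum => k; exact: (measurableT_comp mg (measurable_orbit hdist cG k)).
  by apply: (measurableT_comp (@normr_measurable _ setT) ms).
by apply/seteqP; split => ux hux n nN; have := hux n nN; rewrite /= in_itv.
Qed.

Lemma walk_take k (t : seq bool) : (k <= size t)%N ->
  walk R (take k t) = \sum_(j < k) sign R (nth false t j).
Proof.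
move=> kt; rewrite /walk (big_nth false) size_takel// big_mkord.
by apply: eq_bigr => j _; rewrite nth_take.
Qed.

(** If [collision N ux < 1], the first [N] orbit points lie fully in distinct cells; the values
    there are independent signs, and confinement makes the walk tame. Otherwise the collision term
    alone exceeds the trivial bound. *)
Lemma sum_confined_le M N ux :
  \sum_(eps : {ffun 'I_J -> bool}) \1_(confined M N (signed eps)) ux <=
  #|{: {ffun 'I_J -> bool}}|%:R *
    (coin_mean N (fun t => (tame R M t)%:R) + collision N ux).
Proof.
have q0 : 0 <= coin_mean N (fun t => (tame R M t)%:R) :> R.
  by rewrite -[leLHS](coin_mean_cst N 0); apply: ler_coin_mean.
have hh0 k l : 0 <= \sum_i h i (ux.2 + ux.1 *+ k) * h i (ux.2 + ux.1 *+ l).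
  by rewrite sumr_ge0// => i _; rewrite mulr_ge0.
have z0 : 0 <= \sum_(k < N) \1_Z (ux.2 + ux.1 *+ k) :> R by rewrite sumr_ge0.
have s0 : 0 <= \sum_(l < N) \sum_(k < l) \sum_i h i (ux.2 + ux.1 *+ k) * h i (ux.2 + ux.1 *+ l).
  by rewrite sumr_ge0// => l _; rewrite sumr_ge0.
have [c1|c1] := lerP 1 (collision N ux).
  apply: (@le_trans _ _ (\sum_(eps : {ffun 'I_J -> bool}) 1)).
    by apply: ler_sum => eps _; rewrite indicE lern1 leq_b1.
  by rewrite sumr_const -[leLHS]mulr1 ler_wpM2l// (le_trans c1)// lerDr.
have /choice[idx hidx] (k : 'I_N) : exists i, 1 <= h i (ux.2 + ux.1 *+ k).
  apply: contrapT => hk; move: c1; rewrite ltNge => /negP; apply.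
  apply: (@le_trans _ _ (\sum_(k < N) \1_Z (ux.2 + ux.1 *+ k))); last by rewrite lerDl.
  rewrite (bigD1 k)//= indicE mem_set ?lerDl ?sumr_ge0//.
  by move=> i; rewrite ltNge; apply/negP => hi; apply: hk; exists i.
have idx_lt (k l : 'I_N) : (k < l)%N -> idx k != idx l.
  move=> kl; apply/negP => /eqP kl'; move: c1; rewrite ltNge => /negP; apply.
  apply: (@le_trans _ _ (\sum_(l < N) \sum_(k < l) \sum_i
    h i (ux.2 + ux.1 *+ k) * h i (ux.2 + ux.1 *+ l))); last by rewrite lerDr.
  rewrite (bigD1 l)//= (bigD1 (Ordinal kl))//= (bigD1 (idx k))//= -!addrA.
  rewrite -[leLHS]addr0; apply: lerD.
    by rewrite -[leLHS]mulr1; apply: ler_pM => //; rewrite ?ler01// kl'.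
  rewrite !addr_ge0// ?sumr_ge0// => i _; rewrite ?mulr_ge0//.
  by rewrite sumr_ge0.
have idx_inj : injective idx.
  move=> k l kl; case: (ltngtP k l) => [lt|lt|]; last exact: val_inj.
    by have := idx_lt _ _ lt; rewrite kl eqxx.
  by have := idx_lt _ _ lt; rewrite kl eqxx.
pose s := [seq idx k | k <- enum 'I_N].
have us : uniq s by rewrite map_inj_uniq// enum_uniq.
have ss : size s = N by rewrite size_map size_enum_ord.
apply: (@le_trans _ _ (\sum_(eps : {ffun 'I_J -> bool}) (tame R M [seq eps i | i <- s])%:R)).
  apply: ler_sum => eps _; rewrite indicE.
  have [hux|_] := boolP (ux \in confined M N (signed eps)); last by [].
  suff -> : tame R M [seq eps i | i <- s] by [].
  apply/tameP => n; rewrite size_map ss => nN.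
  rewrite walk_take; last by rewrite size_map ss.
  move: hux; rewrite inE => /(_ n nN); congr (`|_| <= _).
  apply: eq_bigr => j _; have jN := leq_trans (ltn_ord j) nN.
  rewrite (nth_map (idx (Ordinal jN))) ?ss//.
  rewrite (nth_map (Ordinal jN)) ?size_enum_ord//.
  have -> : nth (Ordinal jN) (enum 'I_N) j = Ordinal jN.
    by apply: val_inj; rewrite /= nth_enum_ord.
  exact: (signed_sum_pinned eps (h0^~ _) (h_sum _) (hidx (Ordinal jN))).
have /= -> := sum_sign_seq (fun t => (tame R M t)%:R : R) us.
rewrite ss ler_wpM2l//.
by rewrite lerDl addr_ge0.
Qed.

Lemma measurable_collision N : measurable_fun setT (collision N).
Proof.
apply: measurable_funD.
  apply: measurable_sum => k.
  exact: (measurableT_comp (measurable_indic mZ) (measurable_orbit hdist cG k)).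
apply: measurable_sum => l; apply: measurable_sum => k; apply: measurable_sum => i.
apply: measurable_funM.
  exact: (measurableT_comp (mh i) (measurable_orbit hdist cG k)).
exact: (measurableT_comp (mh i) (measurable_orbit hdist cG l)).
Qed.

Lemma collision_ge0 N ux : 0 <= collision N ux.
Proof.
rewrite addr_ge0 ?sumr_ge0// => l _; rewrite sumr_ge0// => k _.
by rewrite sumr_ge0// => i _; rewrite mulr_ge0.
Qed.

Lemma measurable_signed eps : measurable_fun setT (signed eps : borel G -> R).
Proof. exact: continuous_measurable_real (@signed_continuous eps). Qed.

(** Average over the signs the sum of the confinement probability and of the weighted squared mean:
    some choice is good for both. The weight [N%:R ^+ 2] turns the mean into the drift accumulated
    in [N] steps. *)
Lemma exists_signs M N (q := coin_mean N (fun t => (tame R M t)%:R) : R) :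
  exists eps, fine (P (confined M N (signed eps))) +
    N%:R ^+ 2 * fine (\int[mu]_z (signed eps z)%:E)%E ^+ 2 <=
  q + (N%:R * eta + N%:R * (N%:R * eta)) + N%:R ^+ 2 * eta.
Proof.
have q0 : 0 <= q by rewrite -[leLHS](coin_mean_cst N 0); apply: ler_coin_mean.
set B := N%:R * eta + _.
set C := #|{: {ffun 'I_J -> bool}}|%:R : R.
have mbad eps : measurable (confined M N (signed eps)).
  exact: measurable_confined (measurable_signed eps).
apply: (@exists_le_mean _ _ [ffun=> true]).
rewrite big_split /= mulrDr; apply: lerD; last first.
  rewrite -mulr_sumr; under eq_bigr do rewrite integral_signed /=.
  rewrite sum_signed_sum_sqr mulrCA -/C; apply: ler_wpM2l => //.
  by apply: ler_wpM2l; [exact: exprn_ge0|exact: sum_mean_sqr_le].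
rewrite -lee_fin -sumEFin -/C.
rewrite (eq_bigr (fun eps => P (confined M N (signed eps)))); last first.
  by move=> eps _; rewrite fineK// product_fin_num.
apply: (@le_trans _ _ (\int[P]_ux (C * (q + collision N ux))%:E)%E).
  rewrite (eq_bigr (fun eps => \int[P]_ux (\1_(confined M N (signed eps)) ux)%:E)%E); last first.
    by move=> eps _; rewrite integral_indic// setIT.
  have mind eps : measurable_fun setT
      (fun ux : Om => (\1_(confined M N (signed eps)) ux : R)%:E).
    by apply: measurableT_comp => //; exact: measurable_indic.
  rewrite -ge0_integral_sum//.
  apply: ge0_le_integral => //.
  - by move=> ux _; rewrite sume_ge0// => eps _; rewrite lee_fin.
  - exact: emeasurable_sum.
  - apply: measurableT_comp => //; apply: measurable_funM => //.
    by apply: measurable_funD => //; exact: measurable_collision.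
  by move=> ux _; rewrite sumEFin lee_fin; exact: sum_confined_le.
under eq_integral do rewrite EFinM.
have mc : measurable_fun setT (fun ux => (collision N ux)%:E).
  by apply: measurableT_comp => //; exact: measurable_collision.
rewrite ge0_integralZl_EFin//; last 2 first.
- by move=> ux _; rewrite lee_fin addr_ge0// collision_ge0.
- by under eq_fun do rewrite EFinD; exact: emeasurable_funD.
rewrite EFinM; apply: lee_wpmul2l; first by rewrite lee_fin.
under eq_integral do rewrite EFinD.
rewrite ge0_integralD//; last by move=> ux _; rewrite lee_fin collision_ge0.
rewrite EFinD; apply: leeD; last exact: integral_collision.
rewrite (integral_cst P) // -[leRHS]mule1.
by apply: lee_wpmul2l; [rewrite lee_fin|exact: (@probability_le1 _ _ _ P)].
Qed.

End signed_partition.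

(** * Continuous functions of mean zero that escape *)

Section escaping.
Variables (R : realType) (G : topologicalZmodType) (dist : G -> G -> R).
Hypotheses (hdist : metrized_by dist) (cG : compact [set: G]).
Hypothesis connG : connected [set: G].
Hypothesis G_nontrivial : exists x : G, x != 0.
Variable mu : probability (borel G) R.
Hypothesis haar_mu : haar_measure mu.

Lemma escaping_function (M : nat) (d : R) : 0 < d ->
  exists (N : nat) (g : G -> R), [/\ (0 < N)%N, continuous g,
    (\int[mu]_z (g z)%:E = 0)%E, forall z, `|g z| <= 2 &
    ((mu \x mu) (confined M N g) <= d%:E)%E].
Proof.
move=> d0; pose d' := Num.min d 1.
have d'0 : 0 < d' by rewrite lt_min d0 ltr01.
have d'd : d' <= d by rewrite ge_min lexx.
have d'1 : d' <= 1 by rewrite ge_min lexx orbT.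
have d'2 : 0 < d' / 2 by rewrite divr_gt0.
have [N N0 hq] := tame_rare M.+1 d'2.
have NR : 0 < N%:R :> R by rewrite ltr0n.
have N1 : 1 <= N%:R :> R by rewrite ler1n.
(* The total coefficient of [eta] in [exists_signs]; these terms then add up to [d' / 2]. *)
pose b : R := N%:R + N%:R * N%:R + N%:R ^+ 2.
have b0 : 0 < b by rewrite !addr_gt0// ?mulr_gt0// exprn_gt0.
pose eta := d' / 2 / b; have eta0 : 0 < eta by rewrite divr_gt0.
have [J [h [ch h0 hs hi hZ]]] := small_partition hdist cG connG G_nontrivial haar_mu eta0.
pose h' (i : 'I_J) := h i.
have hs' z : \sum_i h' i z <= 1 by have := hs z; rewrite big_mkord.
have hi' i : (\int[mu]_z (h' i z)%:E <= eta%:E)%E by exact: hi.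
have hZ' : (mu [set z | forall i, (h' i z < 1)%R] <= eta%:E)%E.
  rewrite (_ : [set z | _] = [set z | forall i, (i < J)%N -> h i z < 1])//.
  apply/seteqP; split => z hz i; last exact: hz.
  by move=> iJ; exact: (hz (Ordinal iJ)).
have [eps] := exists_signs hdist cG connG haar_mu (fun i => ch i)
  (fun i => h0 i) hs' hi' hZ' M.+1 N.
set f := signed h' eps; set m := fine (\int[mu]_z (f z)%:E)%E.
set pb := fine _ => hpb.
have mf : measurable_fun setT (f : borel G -> R).
  exact (measurable_signed (h := h') (fun i => ch i) eps).
have cf : continuous f by exact (signed_continuous (h := h') (fun i => ch i) (eps := eps)).
have pb0 : 0 <= pb by rewrite fine_ge0// measure_ge0.
have hB : pb + N%:R ^+ 2 * m ^+ 2 <= d'.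
  apply: le_trans hpb _.
  have -> : d' = d' / 2 + eta * b by rewrite /eta divfK ?gt_eqF//; field.
  rewrite -addrA; apply: lerD => //.
  by rewrite le_eqVlt /b; apply/orP; left; apply/eqP; ring.
have Nm : N%:R * `|m| <= 1.
  rewrite -(@expr_le1 _ 2) ?mulr_ge0// exprMn real_normK ?num_real//.
  by apply: le_trans d'1; apply: le_trans hB; rewrite lerDr.
have m1 : `|m| <= 1 by apply: le_trans Nm; apply: ler_peMl.
have fint : mu.-integrable setT (EFin \o f).
  apply: (@bounded_integrable _ _ _ _ _ 1) => // z.
  exact (norm_signed_le1 (h := h') (fun i => h0 i) hs' eps z).
have cfm : continuous (fun z => f z - m).
  by move=> z; apply: cvgB; [exact: cf|exact: cvg_cst].
exists N, (fun z => f z - m); split => //.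
- under eq_integral do rewrite EFinB.
  rewrite integralB//; last exact: finite_measure_integrable_cst.
  rewrite integral_cst// /m fineK ?integrable_fin_num//.
  rewrite [X in (_ - _ * X)%E](_ : _ = 1%E); last exact: probability_setT.
  by rewrite mule1 subee// integrable_fin_num.
- move=> z; apply: le_trans (ler_normB _ _) _.
  have := norm_signed_le1 (h := h') (fun i => h0 i) hs' eps z.
  by rewrite -/(f z); lra.
have mc := measurable_confined hdist cG M.+1 N mf.
apply: (@le_trans _ _ ((mu \x mu)%E (confined M.+1 N f))).
  apply: le_measure; rewrite ?inE//.
    exact: (measurable_confined hdist cG M N (continuous_measurable_real cfm)).
  move=> ux hux n nN; have := hux n nN.
  rewrite sumrB sumr_const card_ord => h1.
  rewrite -natr1 mulrDl mul1r.
  set S := \sum_(k < n) _ in h1 *.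
  have : `|S| <= `|S - m *+ n| + `|m *+ n|.
    by rewrite -{1}(subrK (m *+ n) S) ler_normD.
  suff : `|m *+ n| <= Num.sqrt n%:R by move: h1; lra.
  case: n nN {h1 S} => [|n] nN; first by rewrite mulr0n normr0 sqrtr_ge0.
  rewrite normrMn -[leLHS]mulr_natl.
  apply: (@le_trans _ _ (N%:R * `|m|)); first by rewrite ler_wpM2r// ler_nat.
  by apply: le_trans Nm _; rewrite -{1}sqrtr1; apply: ler_wsqrtr; rewrite ler1n.
have -> : (mu \x mu)%E (confined M.+1 N f) = pb%:E.
  by rewrite /pb fineK// product_fin_num.
rewrite lee_fin.
apply: le_trans d'd; apply: le_trans hB.
by rewrite lerDl mulr_ge0 ?sqr_ge0.
Qed.

End escaping.

(** * Genericity *)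

Section of_real.
Variables (R : realType) (s : scalars).

Definition of_real : R -> scalar_field R s :=
  match s with
  | RealScalars => fun x : R => x
  | ComplexScalars => fun x : R => x%:C%C
  end.

Lemma of_realD x y : of_real (x + y) = of_real x + of_real y.
Proof. by rewrite /of_real; case: s => //=; rewrite -rmorphD. Qed.

Lemma of_realN x : of_real (- x) = - of_real x.
Proof. by rewrite /of_real; case: s => //=; rewrite -rmorphN. Qed.

Lemma of_real_sum (I : Type) (r : seq I) (F : I -> R) :
  of_real (\sum_(i <- r) F i) = \sum_(i <- r) of_real (F i).
Proof.
apply: (big_morph _ of_realD).
by rewrite /of_real; case: s => //=; rewrite rmorph0.
Qed.

Lemma modulus_of_real x : modulus (of_real x) = `|x|.
Proof.
by rewrite /of_real; case: s => //=; rewrite expr0n addr0 sqrtr_sqr.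
Qed.

Lemma re_part_of_real x : re_part (of_real x) = x.
Proof. by rewrite /of_real; case: s. Qed.

Lemma im_part_of_real x : im_part (of_real x) = 0.
Proof. by rewrite /of_real; case: s. Qed.

Lemma of_real_continuous : continuous of_real.
Proof.
rewrite /of_real; case: s => /= x; first exact: cvg_id.
apply/cvgrPdist_lt => e e0.
have /andP[/eqP ime ree] : (complex.Im e == 0) && (0 < complex.Re e).
  by move: e0; rewrite ltcE /= eq_sym.
have /cvgrPdist_lt/(_ _ ree) := @cvg_id _ (nbhs x).
apply: filterS => y xy; rewrite -rmorphB normc_def /= expr0n addr0 sqrtr_sqr.
by rewrite ltcE /= ime eqxx.
Qed.

End of_real.

(** * Dense open sets of escaping functions *)

Section escaping_balls.
Variables (R : realType) (s : scalars) (G : topologicalZmodType).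
Variable dist : G -> G -> R.
Hypotheses (hdist : metrized_by dist) (cG : compact [set: G]).
Hypothesis connG : connected [set: G].
Hypothesis G_nontrivial : exists x : G, x != 0.
Variable mu : probability (borel G) R.
Hypothesis haar_mu : haar_measure mu.

Local Notation Om := (borel G * borel G)%type.
Local Notation P := (mu \x mu)%E.
Local Notation C := (C0_space mu s cG).

Definition scalar_confined (M N : nat) (f : G -> scalar_field R s) : set Om :=
  [set ux | forall n, (n <= N)%N ->
    modulus (ergodic_sum n ux.1 f ux.2) <= M%:R * Num.sqrt n%:R].

Lemma measurable_scalar_confined M N f : continuous f ->
  measurable (scalar_confined M N f).
Proof.
move=> cf; have mf := continuous_measurable cf.
rewrite (_ : scalar_confined M N f = \bigcap_(n in [set n | (n <= N)%N])
   ((fun ux : Om => modulus (ergodic_sum n ux.1 f ux.2)) @^-1`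
     `]-oo, (M%:R * Num.sqrt n%:R)]%classic)).
  apply: bigcap_measurableType => n _; rewrite -[_ @^-1` _]setTI.
  by apply: (measurable_modulus_ergodic_sum hdist cG mf n).
by apply/seteqP; split => ux hux n nN; have := hux n nN; rewrite /= in_itv.
Qed.

Lemma modulus_sum_le n (F : nat -> scalar_field R s) c :
  (forall k, modulus (F k) <= c) -> modulus (\sum_(k < n) F k) <= n%:R * c.
Proof.
move=> Fc; elim: n => [|n IH].
  by rewrite big_ord0 mul0r (_ : modulus _ = 0)//; exact/modulus_eq0.
rewrite big_ord_recr/= (le_trans (modulusD _ _))// -[n.+1%:R]natr1 mulrDl mul1r.
by rewrite lerD.
Qed.

Lemma ergodic_sumB n u (f g : G -> scalar_field R s) x :
  ergodic_sum n u (fun z => f z - g z) x = ergodic_sum n u f x - ergodic_sum n u g x.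
Proof. by rewrite /ergodic_sum sumrB. Qed.

(** A uniform error of at most 1/N changes a sum of n <= N terms by at most 1, hence by at most sqrt
    n when n >= 1; both sides vanish for n = 0. *)
Lemma scalar_confined_near M N (f g : C) : (0 < N)%N -> ball g N%:R^-1 f ->
  scalar_confined M N f `<=` scalar_confined M.+1 N g.
Proof.
move=> N0 fg ux hux n nN.
have h : modulus (@ergodic_sum R G s n ux.1 (fun z => g z - f z) ux.2) <= n%:R * N%:R^-1.
  apply: (@modulus_sum_le n (fun k => g (ux.2 + ux.1 *+ k) - f (ux.2 + ux.1 *+ k))) => k.
  by apply: le_trans (le_sup_dist cG g f _) _; exact: (ltW fg).
rewrite (_ : ergodic_sum _ _ _ _ = @ergodic_sum R G s n ux.1 f ux.2 +
    @ergodic_sum R G s n ux.1 (fun z => g z - f z) ux.2); last first.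
  by rewrite ergodic_sumB addrC subrK.
apply: le_trans (modulusD _ _) _; rewrite -[M.+1%:R]natr1 mulrDl mul1r.
apply: lerD; first exact: hux.
apply: le_trans h _; case: n nN => [|n] nN; first by rewrite mul0r sqrtr_ge0.
apply: (@le_trans _ _ 1); first by rewrite ler_pdivrMr ?ltr0n// mul1r ler_nat.
by rewrite -{1}sqrtr1; apply: ler_wsqrtr; rewrite ler1n.
Qed.

Lemma C0_perturbation (f : C) (g : G -> R) t : continuous g ->
  (forall z, `|g z| <= 2) -> (\int[mu]_z (g z)%:E = 0)%E ->
  exists f' : C, forall z, f' z = f z + of_real s (t * g z).
Proof.
move=> cg g2 ig.
pose k z := f z + of_real s (t * g z).
have ck : continuous k.
  move=> z.
  have c2 : {for z, continuous (fun z => of_real s (t * g z))}.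
    apply: (@continuous_comp _ _ _ (fun z => t * g z) (of_real s)).
      by apply: cvgM; [exact: cvg_cst|exact: cg].
    exact: of_real_continuous.
  have c1 : {for z, continuous (C0_fun f)} by exact: C0_continuous.
  exact: (@cvg_comp2 _ _ _ _ _ _ _ _ _ _ _ _ _ (fun a b : scalar_field R s => a + b)
    c1 c2 (@add_continuous (scalar_field R s) (f z, of_real s (t * g z)))).
have [B hB] : exists B, forall z, modulus (f z) <= B.
  have G0 : [set: G] !=set0 by exists 0.
  have [|c _ hc] := @compact_EVT_max _ R (fun z => modulus (f z)) _ G0 cG.
    apply: continuous_subspaceT => z.
    apply: (@continuous_comp _ _ _ (C0_fun f)); first exact: C0_continuous.
    exact: modulus_continuous.
  by exists (modulus (f c)) => z; apply: hc; rewrite inE.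
have mf := continuous_measurable (C0_continuous (c := f)).
have ire : mu.-integrable setT (fun x => (re_part (f x))%:E).
  apply: (@bounded_integrable _ _ (borel G) mu (fun x => re_part (f x)) B
    (measurable_re_part mf)) => z.
  exact: le_trans (re_part_le _) (hB z).
have iim : mu.-integrable setT (fun x => (im_part (f x))%:E).
  apply: (@bounded_integrable _ _ (borel G) mu (fun x => im_part (f x)) B
    (measurable_im_part mf)) => z.
  exact: le_trans (im_part_le _) (hB z).
have [re0 im0] := integral_parts0 ire iim (C0_integral0 f).
have igi : mu.-integrable setT (EFin \o g).
  exact: (@bounded_integrable _ _ (borel G) mu g 2
    (continuous_measurable_real cg) g2).
have k0 : scalar_integral mu k = 0.
  have hre : (\int[mu]_x (re_part (k x))%:E = 0)%E.
    under eq_integral do rewrite re_partD re_part_of_real EFinD EFinM.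
    rewrite integralD//; last exact: (integrableZl measurableT _ igi).
    rewrite re0 add0e.
    by rewrite (integralZl measurableT igi) ig mule0.
  have him : (\int[mu]_x (im_part (k x))%:E = 0)%E.
    by under eq_integral do rewrite im_partD im_part_of_real addr0.
  move: hre him; rewrite /scalar_integral /re_part /im_part; move: k {ck}.
  case: (s) => k hre him; rewrite /Rintegral; first by rewrite hre.
  by rewrite hre him.
by exists (MkC0 ck k0).
Qed.

(** Asking for level [M.+1] at the centre leaves room for [scalar_confined_near]: every member is
    confined at level [M] with probability at most [M.+1%:R^-1]. Taking interiors makes openness
    immediate. *)
Definition escaping_ball (M : nat) : set C :=
  \bigcup_(gN in [set gN : C * nat | (0 < gN.2)%N /\
     (P (scalar_confined M.+1 gN.2 gN.1) <= (M.+1%:R^-1)%:E)%E])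
    (ball gN.1 gN.2%:R^-1)^°.

Lemma open_escaping_ball M : open (escaping_ball M).
Proof. by apply: bigcup_open => gN _; exact: open_interior. Qed.

Lemma dense_escaping_ball M : dense (escaping_ball M).
Proof.
move=> U [f0 Uf0] oU.
have /nbhs_ballP[e /= e0 eU] : nbhs f0 U by exact: open_nbhs_nbhs.
(* The [L] perturbations of [f0] by [tau * i%:R] times [g] stay within [e / 2], as [|g| <= 2]. The
   mean of their confinement probabilities will be at most 2 / L, that is 1 / (M + 1). *)
pose L := (2 * M.+1)%N; have L0 : 0 < L%:R :> R by rewrite ltr0n.
pose tau := e / (4 * L%:R); have tau0 : 0 < tau by rewrite divr_gt0// mulr_gt0.
have tauE : tau * L%:R * 2 = e / 2 by rewrite /tau; field; rewrite gt_eqF.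
(* If two perturbations are confined at level [M.+1], their difference is at level [2 * M.+1];
   dividing by [tau] confines [g] at level [M']. *)
clearbody tau; pose M' := Num.bound (2 * M.+1%:R / tau).
have hM' : 2 * M.+1%:R <= M'%:R * tau.
  rewrite -ler_pdivrMr//; apply: ltW; apply: archi_boundP.
  by rewrite divr_ge0 ?mulr_ge0// ltW.
have Linv : 0 < L%:R^-1 :> R by rewrite invr_gt0.
have [N [g [N0 cg ig g2 hg]]] := escaping_function hdist cG connG G_nontrivial
  haar_mu M' Linv.
have /choice[f hf] (i : 'I_L) := C0_perturbation f0 (tau * i%:R) cg g2 ig.
pose E i := scalar_confined M.+1 N (f i).
have mE i : measurable (E i).
  by apply: measurable_scalar_confined; exact: C0_continuous.
have mg := measurable_confined hdist cG M' N (continuous_measurable_real cg).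
have disj ux (i j : 'I_L) : (j < i)%N -> E i ux -> E j ux -> confined M' N g ux.
  move=> ij Ei Ej n nN.
  have := Ei n nN; have := Ej n nN.
  set a := @ergodic_sum R G s n ux.1 (f i) ux.2.
  set b := @ergodic_sum R G s n ux.1 (f j) ux.2.
  set S := \sum_(k < n) g _ => hb ha.
  have abS : a - b = of_real s (tau * (i - j)%:R * S).
    rewrite /a /b -ergodic_sumB /ergodic_sum /S mulr_sumr of_real_sum.
    apply: eq_bigr => k _; rewrite !hf opprD addrACA subrr add0r.
    rewrite -of_realN -of_realD -mulrBl -mulrBr natrB//.
    exact: ltnW.
  have := modulusD a (- b); rewrite modulusN abS modulus_of_real !normrM.
  rewrite (gtr0_norm tau0) ger0_norm// => hS.
  have r0 : 0 <= Num.sqrt n%:R :> R by exact: sqrtr_ge0.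
  have h1 : tau * `|S| <= 2 * M.+1%:R * Num.sqrt n%:R.
    apply: (@le_trans _ _ (tau * (i - j)%:R * `|S|)).
      apply: ler_wpM2r => //; rewrite -[leLHS]mulr1 ler_wpM2l ?(ltW tau0)//.
      by rewrite ler1n subn_gt0.
    apply: le_trans hS _; rewrite -mulrA mulr_natl mulr2n.
    exact: lerD ha hb.
  rewrite -(ler_pM2l tau0); apply: le_trans h1 _; rewrite mulrA [tau * _]mulrC.
  exact: ler_wpM2r.
(* Away from the event that [g] is confined, at most one perturbation is; on this event there are at
   most [L], and its probability is at most [L%:R^-1]. *)
have sumE ux : \sum_i \1_(E i) ux <= 1 + L%:R * \1_(confined M' N g) ux :> R.
  rewrite [in leRHS]indicE; have [_|hux] := boolP (ux \in confined M' N g).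
    apply: (@le_trans _ _ (\sum_(i < L) 1)).
      by apply: ler_sum => i _; rewrite indicE lern1 leq_b1.
    by rewrite sumr_const card_ord mulr1 lerDr.
  rewrite mulr0 addr0.
  have [[i Ei]|nE] := pselect (exists i, E i ux); last first.
    rewrite big1// => i _; rewrite indicE memNset// => Ei; apply: nE; by exists i.
  rewrite (bigD1 i)//= [X in _ + X]big1 ?addr0 => [|j ji].
    by rewrite indicE lern1 leq_b1.
  rewrite indicE memNset// => Ej; move: hux; rewrite notin_setE; apply.
  have [ij|ij|ij] := ltngtP i j; [exact: disj ij Ej Ei|exact: disj ij Ei Ej|].
  by move: ji; rewrite -val_eqE /= ij eqxx.
have [i hi] : exists i, fine (P (E i)) <= M.+1%:R^-1.
  have i0 : 'I_L by exact: (Ordinal (isT : (0 < L)%N)).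
  apply: (@exists_le_mean _ _ i0).
  rewrite -lee_fin -sumEFin.
  have mind i : measurable_fun setT (fun ux : Om => (\1_(E i) ux : R)%:E).
    by apply: measurableT_comp => //; exact: measurable_indic.
  rewrite (eq_bigr (fun i => \int[P]_ux (\1_(E i) ux)%:E)%E); last first.
    by move=> i _; rewrite fineK ?product_fin_num// integral_indic// setIT.
  rewrite -ge0_integral_sum//.
  have mc : measurable_fun setT (fun ux : Om => (\1_(confined M' N g) ux : R)%:E).
    by apply: measurableT_comp => //; exact: measurable_indic.
  apply: (@le_trans _ _ (\int[P]_ux (1%:E + L%:R%:E * (\1_(confined M' N g) ux)%:E))%E).
    apply: ge0_le_integral => //.
    - by move=> ux _; rewrite sume_ge0// => i _; rewrite lee_fin.
    - exact: emeasurable_sum.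
    - by apply: emeasurable_funD => //; exact: measurable_funeM.
    by move=> ux _; rewrite sumEFin -EFinM -EFinD lee_fin; exact: sumE.
  rewrite ge0_integralD//; last exact: measurable_funeM.
  rewrite ge0_integralZl_EFin// integral_indic// setIT.
  rewrite (integral_cst P)// mul1e.
  apply: (@le_trans _ _ (1%:E + L%:R%:E * (L%:R^-1)%:E)%E).
    apply: leeD; first exact: (@probability_le1 _ _ _ P).
    by apply: lee_wpmul2l => //; rewrite lee_fin.
  rewrite -EFinM -EFinD lee_fin divff ?gt_eqF// card_ord /L natrM.
  by rewrite mulfK// pnatr_eq0.
exists (f i); split.
  apply: eU.
  apply: (@le_lt_trans _ _ (e / 2)); last by rewrite ltr_pdivrMr// ltr_pMr// ltr1n.
  apply: sup_dist_le => z; rewrite hf opprD addrA subrr sub0r modulusN modulus_of_real.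
  rewrite !normrM (gtr0_norm tau0) ger0_norm//.
  apply: (@le_trans _ _ (tau * L%:R * 2)).
    apply: ler_pM => //; first by rewrite mulr_ge0// ltW.
    by apply: ler_wpM2l; [exact: ltW|rewrite ler_nat ltnW].
  by rewrite tauE.
exists (f i, N) => /=.
  split => //; apply: le_trans (_ : ((fine (P (E i)))%:E <= _)%E); last by rewrite lee_fin.
  by rewrite fineK ?product_fin_num.
have : nbhs (f i) (ball (f i) N%:R^-1) by apply: nbhsx_ballx; rewrite invr_gt0 ltr0n.
exact.
Qed.

End escaping_balls.

(** * The second assertion for a fixed function *)

Section limsup_infinite.
Variables (R : realType) (s : scalars) (G : topologicalZmodType).
Variable dist : G -> G -> R.
Hypotheses (hdist : metrized_by dist) (cG : compact [set: G]).
Variable mu : probability (borel G) R.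

Local Notation Om := (borel G * borel G)%type.
Local Notation P := (mu \x mu)%E.

Lemma limn_esup_lty_bounded (u : nat -> R) : (forall n, 0 <= u n) ->
  (limn_esup (EFin \o u) < +oo)%E -> exists K : nat, forall n, u n <= K%:R.
Proof.
move=> u0 /ereal_inf_lt[_ [V [n0 _ n0V] <-] supV].
have [c hc] : exists c : R, forall n, (n0 <= n)%N -> u n <= c.
  have [c0|] := eqVneq (ereal_sup ((EFin \o u) @` V)) -oo%E.
    exists 0 => n n0n; have : ((u n)%:E <= -oo)%E.
      by rewrite -c0; apply: ereal_sup_ubound; exists n => //; exact: n0V.
    by [].
  move: supV; case E : (ereal_sup _) => [c| |]// _ _.
  exists c => n n0n; rewrite -lee_fin -E; apply: ereal_sup_ubound.
  by exists n => //; exact: n0V.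
have c0 : 0 <= c by rewrite (le_trans (u0 n0))// hc.
(* The sum accounts for the finitely many terms before [n0], so that the bound holds for every
   [n]. *)
pose b := c + \sum_(n < n0) u n.
have b0 : 0 <= b by rewrite addr_ge0// sumr_ge0.
exists (Num.bound b) => n; apply: le_trans (ltW (archi_boundP b0)).
have [n0n|nn0] := leqP n0 n.
  by rewrite (le_trans (hc n n0n))// lerDl sumr_ge0.
by rewrite /b (bigD1 (Ordinal nn0))//= addrCA lerDl addr_ge0// sumr_ge0.
Qed.

Lemma limsup_ergodic_lty (f : G -> scalar_field R s) (u x : G) :
  limsup_ergodic (1 / 2) f u x != +oo%E ->
  exists K : nat, forall n, modulus (ergodic_sum n u f x) <= K%:R * Num.sqrt n%:R.
Proof.
rewrite -ltey => /limn_esup_lty_bounded[n|K hK].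
  by rewrite divr_ge0 ?modulus_ge0 ?powR_ge0.
exists K => -[|n].
  by rewrite /ergodic_sum big_ord0 sqrtr0 mulr0 (_ : modulus _ = 0)//; exact/modulus_eq0.
by have := hK n.+1; rewrite /= mul1r powR12_sqrt// ler_pdivrMr//.
Qed.

Lemma limsup_ergodic_infinite (f : C0_space mu s cG) :
  (forall M, escaping_ball (cG := cG) (mu := mu) (s := s) M f) ->
  P [set ux : Om | limsup_ergodic (1 / 2) f ux.1 ux.2 = +oo%E] = 1%E.
Proof.
move=> hf; set A := [set _ | _].
have cf : continuous (C0_fun f) by exact: C0_continuous.
have mf := continuous_measurable cf.
have mA : measurable A.
  have := measurable_limsup_ergodic hdist cG mf (1 / 2).
  by move=> /(_ measurableT [set +oo%E] (emeasurable_set1 _)); rewrite setTI.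
have /choice[N hN] M : exists N, (P (scalar_confined M N f) <= (M.+1%:R^-1)%:E)%E.
  have [[g N] /= [N0 hg] /interior_subset fg] := hf M.
  exists N; apply: le_trans hg; apply: le_measure; rewrite ?inE.
  - exact: measurable_scalar_confined hdist cG _ _ _ cf.
  - by apply: (measurable_scalar_confined hdist cG); exact: C0_continuous.
  exact: scalar_confined_near.
(* A finite upper limit gives |S_n| <= K sqrt n for all n and some integer [K], hence membership in
   [B K]. This set is null, as it lies in events of probability at most 1 / (M + 1) for every M >=
   K. *)
pose B (K : nat) : set Om := \bigcap_(M in [set M | (K <= M)%N]) scalar_confined M (N M) f.
have mB K : measurable (B K).
  by apply: bigcap_measurableType => M _; exact: measurable_scalar_confined hdist cG _ _ _ cf.
have B0 K : P (B K) = 0%E.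
  apply/eqP; rewrite eq_le measure_ge0 andbT; apply/lee_addgt0Pr => e e0.
  rewrite add0e; have [n hn] := exists_natS_mul_ge1 e0.
  pose M := maxn K n.
  apply: (@le_trans _ _ (M.+1%:R^-1)%:E).
    apply: le_trans (hN M); apply: le_measure; rewrite ?inE//.
      exact: measurable_scalar_confined hdist cG _ _ _ cf.
    by move=> ux; apply; rewrite /= /M leq_maxl.
  rewrite lee_fin -[leRHS]mul1r -ler_pdivrMr// -invfM invf_le1 ?mulr_gt0//.
  by apply: le_trans hn _; rewrite ler_pM2r// ler_nat ltnS leq_maxr.
have AB : ~` A `<=` \bigcup_K B K.
  move=> ux /eqP/limsup_ergodic_lty[K hK]; exists K => // M /= KM n _.
  by apply: le_trans (hK n) _; rewrite ler_wpM2r ?sqrtr_ge0// ler_nat.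
have : P (~` A) = 0%E.
  apply/(negligibleP _ (measurableC mA)).
  apply: negligibleS AB _; apply: negligible_bigcup => K.
  by exists (B K); split; [exact: mB|exact: B0|exact: subset_refl].
move=> PAC; have := etrans (esym PAC) (probability_setC (mu \x mu)%E mA) => /esym/eqP.
by rewrite sube_eq ?add0e ?product_fin_num // => /eqP/esym.
Qed.

End limsup_infinite.

Theorem theorem1p2 (R : realType) (s : scalars) (G : topologicalZmodType)
    (dist : G -> G -> R) (hdist : metrized_by dist)
    (cG : compact [set: G]) (connG : connected [set: G])
    (G_nontrivial : exists x : G, x != 0)
    (mu : probability (borel G) R) (haar_mu : haar_measure mu) :
  (forall (nu : R) (f : G -> scalar_field R s), 1 / 2 < nu -> L2_0 mu f ->
     (mu \x mu)%E [set ux : borel G * borel G |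
       (1 <= limsup_ergodic nu f ux.1 ux.2)%E] = 0%E) /\
  (exists Res : set (C0_space mu s cG), residual Res /\
     forall f : C0_space mu s cG, Res f ->
       (mu \x mu)%E [set ux : borel G * borel G |
         limsup_ergodic (1 / 2) f ux.1 ux.2 = +oo%E] = 1%E).
Proof.
split=> [nu f|]; first exact: (null_limsup_ergodic hdist).
exists (\bigcap_M escaping_ball M); split.
  exists (\bigcap_M escaping_ball M) => //; exists (@escaping_ball R s G cG mu) => //.
  move=> M; split; first exact: open_escaping_ball.
  exact: (dense_escaping_ball hdist).
by move=> f hf; apply: (limsup_ergodic_infinite hdist) => M; exact: hf.
Qed.
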